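(* Assume that the family of nonempty compact sets $(T_1,\dots,T_n)$ in $\mathbb{R}^d$ satisfies the multi-tile functional equation $$A(T_i)=\bigcup_{j=1}^n(T_j+\mathcal{D}_{ji}),\qquad 1\le i\le n,$$ with data $(A,\mathcal{D}_{ij})$ whose subdivision matrix $S=[|\mathcal{D}_{ij}|]_{1\le i,j\le n}$ is primitive and satisfies the Perron eigenvalue condition $\lambda(S)=|\det(A)|$. Then the following conditions are equivalent: (i) For $m\ge1$ all multisets $\mathcal{D}_{ij}^m$, $1\le i,j\le n$, are ordinary sets, and the family $\{\mathcal{D}_{ij}^m:1\le i,j\le n,\ m\ge1\}$ is equi-uniformly discrete. (ii) For some fixed $1\le k,l\le n$, the multisets $\mathcal{D}_{kl}^m$, $m\ge1$, are all ordinary sets and the family $\{\mathcal{D}_{kl}^m:m\ge1\}$ is equi-uniformly discrete. (iii) The family of multisets $\{\mathcal{D}_{ij}^m:1\le i,j\le n,\ m\ge1\}$ is weakly equi-uniformly discrete. (iv) For some fixed $1\le k,l\le n$ the family of multisets $\{\mathcal{D}_{kl}^m:m\ge1\}$ is weakly equi-uniformly discrete. (v) One set $T_j$ has $\mu(T_j)>0$. (vi) Every set $T_j$ has $T_j=\overline{T_j^\circ}$, hence all $\mu(T_j)>0$. (vii) For each $1\le j\le n$, $T_j=\overline{T_j^\circ}$ and $\mu(\partial T_j)=0$.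
   Context: $d,n\ge1$ are integers, $A$ is an expanding real $d\times d$ matrix (all eigenvalues, real or complex, have absolute value $>1$), and $\mathcal{D}_{ij}\subset\mathbb{R}^d$, $1\le i,j\le n$, are finite, possibly empty, sets. $\mu$ is Lebesgue measure, $T^\circ$ is the interior and $\partial T$ the boundary of $T$. A nonnegative real square matrix is primitive if some power has all entries strictly positive; its Perron eigenvalue $\lambda(\cdot)$ is its positive real simple eigenvalue equal to its spectral radius. A multiset is a set (the underlying set) with a positive-integer-valued multiplicity function; it is an ordinary set if all multiplicities are $1$. The multiset union $\bigvee$ adds multiplicity functions. The digit multisets are $$\mathcal{D}_{ji}^m:=\bigvee_{j_1,\dots,j_{m-1}=1}^n(\mathcal{D}_{jj_{m-1}}+A\mathcal{D}_{j_{m-1}j_{m-2}}+\cdots+A^{m-1}\mathcal{D}_{j_1i}),$$ where sums are formed counting multiplicities (each choice of one digit from each summand contributes $1$ to the multiplicity of the resulting point). A family of discrete multisets $\{\mathcal{E}_\alpha\}$ in $\mathbb{R}^d$ is equi-uniformly discrete if there is $\varepsilon_0>0$ such that each $\mathcal{E}_\alpha$ is uniformly discrete (in particular an ordinary set) and any two distinct elements of $\mathcal{E}_\alpha$ are at distance at least $\varepsilon_0$. It is weakly equi-uniformly discrete if there is $M>0$ such that for each $\alpha$ and each ball $B$ of radius $1$ in $\mathbb{R}^d$, the number of elements of $\mathcal{E}_\alpha$ in $B$, counted with multiplicity, is at most $M$. *)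

(* Defs.v *)
From HB Require Import structures.
Set Warnings "-notation-overridden,-notation-incompatible-prefix".
From mathcomp Require Export all_boot all_order all_algebra.
From mathcomp Require Export finmap multiset complex.
From mathcomp Require Export all_classical all_reals all_analysis.
Export numFieldNormedType.Exports.

Set Implicit Arguments.
Unset Strict Implicit.
Unset Printing Implicit Defensive.

Import Order.TTheory GRing.Theory Num.Theory.

Local Open Scope classical_set_scope.
Local Open Scope ring_scope.

Section EuclideanSpace.
Variables (R : realType) (d : nat).
Implicit Types (x a b : 'cV[R]_d) (X : set 'cV[R]_d).

(* The library norm on matrices is the sup norm. *)
Definition enorm x : R := Num.sqrt (\sum_i x i 0 ^+ 2).

Definition boundary X : set 'cV[R]_d := closure X `\` interior X.

Definition box a b : set 'cV[R]_d :=
  [set x | forall i, a i 0 <= x i 0 <= b i 0].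

(* [Num.max 0] gives the empty boxes volume 0. *)
Definition box_vol a b : R := \prod_i Num.max 0 (b i 0 - a i 0).

(* The d-dimensional Lebesgue (outer) measure, for d >= 1: the library only has
   the case of the line. On Lebesgue measurable sets, in particular on Borel
   sets, it is the Lebesgue measure. *)
Definition lebesgue_mu X : \bar R :=
  ereal_inf [set (\sum_(0 <= k <oo) (box_vol (c k).1 (c k).2)%:E)%E
    | c in [set c : nat -> 'cV[R]_d * 'cV[R]_d
            | X `<=` \bigcup_k box (c k).1 (c k).2]].

End EuclideanSpace.

Section Matrices.
Variables (R : realType) (n : nat).
Implicit Types A S : 'M[R]_n.

Definition complex_eigenvalue A (z : R[i]) : Prop :=
  eigenvalue (map_mx (real_complex R) A) z.

Definition expanding A : Prop :=
  forall z : R[i], complex_eigenvalue A z -> 1 < `|z|.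

(* The exponent has to be positive, otherwise the 1 x 1 zero matrix would be
   primitive. *)
Definition primitive_mx S : Prop :=
  (forall i j, 0 <= S i j) /\
  exists2 k : nat, (0 < k)%N & forall i j, 0 < (S ^+ k) i j.

Definition is_spectral_radius A (r : R) : Prop :=
  (exists2 z, complex_eigenvalue A z & `|z| = (r%:C)%C) /\
  (forall z, complex_eigenvalue A z -> `|z| <= (r%:C)%C).

Definition is_perron_eigenvalue S (lam : R) : Prop :=
  [/\ 0 < lam, eigenvalue S lam, mup lam (char_poly S) = 1%N
    & is_spectral_radius S lam].

End Matrices.

Section Multisets.
Variables (R : realType) (d : nat).
Local Notation V := 'cV[R]_d.
Local Open Scope mset_scope.
Implicit Types (E : {mset V}) (F : set {mset V}).

Definition ordinary E : Prop := forall x, x \in E -> E x = 1%N.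

Definition uniformly_discrete (eps : R) E : Prop :=
  ordinary E /\
  forall x y, x \in E -> y \in E -> x != y -> eps <= enorm (x - y).

Definition equi_uniformly_discrete F : Prop :=
  exists2 eps : R, 0 < eps & forall E, F E -> uniformly_discrete eps E.

Definition count_ball E (c : V) (r : R) : nat :=
  (\sum_(x <- finsupp E | (enorm (x - c) <= r)%R) E x)%N.

Definition weakly_equi_uniformly_discrete F : Prop :=
  exists2 M : nat, (0 < M)%N &
    forall E, F E -> forall c, (count_ball E c 1 <= M)%N.

(* Sum and linear image of multisets, counted with multiplicity. *)
Definition mset_add E1 E2 : {mset V} :=
  seq_mset [seq x + y | x <- (E1 : seq V), y <- (E2 : seq V)].

Definition mset_mulmx (B : 'M[R]_d) E : {mset V} :=
  seq_mset [seq B *m x | x <- (E : seq V)].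

Definition mset_of_fset (X : {fset V}) : {mset V} := seq_mset (X : seq V).

(* The multiset D^m_{ji}: the multiset union over all words J = (j_0, ..., j_m)
   with j_0 = i and j_m = j of the sums of the A^k D_{j_{m-k} j_{m-k-1}},
   0 <= k < m. *)
Definition digit_mset n (A : 'M[R]_d) (D : 'I_n -> 'I_n -> {fset V})
    (m : nat) (j i : 'I_n) : {mset V} :=
  \big[msetD/mset0]_(J : {ffun 'I_m.+1 -> 'I_n} | (J ord0 == i) && (J ord_max == j))
    \big[mset_add/[mset 0]]_(k < m)
      mset_mulmx (A ^+ k) (mset_of_fset (D (J (inord (m - k))) (J (inord (m - k).-1)))).

End Multisets.

Definition subdivision_mx (R : realType) d n
    (D : 'I_n -> 'I_n -> {fset 'cV[R]_d}) : 'M[R]_n :=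
  \matrix_(i, j) (#|` D i j|)%:R.

Definition multi_tile_equation (R : realType) d n (A : 'M[R]_d)
    (D : 'I_n -> 'I_n -> {fset 'cV[R]_d}) (T : 'I_n -> set 'cV[R]_d) : Prop :=
  forall i, [set A *m x | x in T i] =
    \bigcup_(j in [set: 'I_n]) [set x + y | x in T j & y in [set` D j i]].

(* Main.v *)
Require Import Defs.
From mathcomp Require Import perm ring lra zify.
Import Order.TTheory GRing.Theory Num.Theory.
Set Implicit Arguments.
Unset Strict Implicit.
Unset Printing Implicit Defensive.
Local Open Scope classical_set_scope.
Local Open Scope ring_scope.

(** Write [lam] for the modulus of the determinant of [A] and [mu] for the outer Lebesgue measure.
    Iterating the functional equation presents the inflated tile [A ^ m T_l] as the union of the
    translates of the tiles [T_k] by the digits of level [m], and the number of these translates is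
    the entry [(S ^ m)_{kl}]. Since [S] is primitive, it has a positive right eigenvector [u] for its
    Perron eigenvalue [lam] ([perron_positive_eigenvector]).

    The engine of the proof is [count_vol_le]. If a family of bounded sets [X_i] is subdivided in
    the same way as the tiles, subadditivity gives [lam ^ m mu(X_l) <= \sum_k (S ^ m)_{kl} mu(X_k)] for
    all [l], and pairing with [u] shows that these inequalities are equalities. Therefore, replacing
    [N] of the translates of [X_k] by a single set [Y] that still completes the cover is possible
    only if [N mu(X_k) <= mu(Y)]. The argument rests on subadditivity alone, which is why it can be
    carried out with outer measures.

    Applied to the tiles, when one of them, and hence by primitivity each of them, has positive
    measure, this yields that digits are not repeated ([Y] is one translate), that the digits in a
    ball are boundedly many ([Y] is a larger ball) and that digits are uniformly separated ([Y] is
    a thin neighbourhood of one translate). So positive measure implies the discreteness of the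
    digits in its strongest form. Applied to the boundaries of tiles that are the closures of their
    interiors, with [Y] empty and the selected piece interior to its tile, it shows that the
    boundaries are null.

    To find interior points, a tile of positive measure is inflated and compared with the unit grid.
    The cells that it meets have nearly the same total volume as the inflated tile ([tile_cells]),
    and a cell meets boundedly many tiles of the subdivision. Were all tiles without interior, finitely
    many of their translates would leave a hole of fixed size in each cell ([finitely_many_porous]),
    so that a fixed proportion of the volume would be lost. So some tile has an interior point,
    and small copies of it are found near every point of every tile ([tile_closure_interior]).

    To get positive measure from the weak discreteness of the digits for one pair of tile types, one
    first passes to all pairs, which is possible because words extend on both sides
    ([weak_bound_transfer]). The number of digits of level [m] is at least of the order of
    [lam ^ m], so the inflated tiles meet that many cells, which is impossible for large [m] if
    all the tiles are null ([vol_gt0_of_weak_bound]).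

    What is used of the outer measure is countable subadditivity, the scaling by [lam] under [A]
    (Gaussian elimination, [scales_by_det_unit]), semicontinuity on compact sets ([mu_thicken]) and
    the lower bound by the number of unit cells ([card_cells_le]). Expansion of [A] enters through
    the convergence to zero of the powers of its inverse ([inverse_powers_vanish]). *)

(** * The supremum norm *)

Section SupNorm.
Variables (R : realType) (d : nat).
Local Notation V := 'cV[R]_d.
Implicit Types (x y a b : V) (X : set V).

Lemma norm_coord x i : `|x i 0| <= `|x|.
Proof.
rewrite [leRHS]/Num.norm /= mx_normrE.
by apply/bigmax_geP; right; exists (i, ord0).
Qed.

Lemma norm_le x r : 0 <= r -> (forall i, `|x i 0| <= r) -> `|x| <= r.
Proof.
move=> r0 H; rewrite [leLHS]/Num.norm /= mx_normrE.
by apply/bigmax_leP; split => // -[i j] _ /=; rewrite (ord1 j).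
Qed.

Lemma interior_normP X x :
  interior X x <-> exists2 r, 0 < r & forall y, `|y - x| < r -> X y.
Proof.
split=> [/nbhs_ballP[r /= r0 H]|[r r0 H]].
  by exists r => // y yr; apply: H; rewrite -ball_normE /= distrC.
apply/nbhs_ballP; exists r => //= y; rewrite -ball_normE /= distrC; exact: H.
Qed.

Lemma compact_norm_bounded X : compact X -> exists2 r, 0 < r & forall x, X x -> `|x| <= r.
Proof.
move=> /compact_bounded [M [_ H]]; exists (Num.max 1 (M + 1)).
  by rewrite lt_max ltr01.
by move=> x /H; apply; rewrite lt_max ltrDl ltr01 orbT.
Qed.

Lemma enorm_le_norm x : enorm x <= d%:R * `|x|.
Proof.
have h : \sum_i x i 0 ^+ 2 <= (d%:R * `|x|) ^+ 2.
  apply: (@le_trans _ _ (\sum_(i < d) `|x| ^+ 2)).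
    apply: ler_sum => i _; rewrite -[leLHS]real_normK ?num_real //.
    by rewrite ler_sqr ?nnegrE ?norm_coord.
  rewrite sumr_const card_ord exprMn -[leLHS]mulr_natl.
  rewrite ler_wpM2r ?sqr_ge0 // -natrX ler_nat.
  by case: (d) => // k; rewrite expnS expn1 leq_pmulr.
apply: le_trans (ler_wsqrtr h) _.
by rewrite sqrtr_sqr ger0_norm // mulr_ge0.
Qed.

Lemma norm_le_enorm x : `|x| <= enorm x.
Proof.
apply: norm_le; first exact: sqrtr_ge0.
move=> i; rewrite -sqrtr_sqr; apply: ler_wsqrtr.
by rewrite (bigD1 i) //= lerDl; apply: sumr_ge0 => j _; exact: sqr_ge0.
Qed.

End SupNorm.

(** * Outer measure *)

Section OuterMeasure.
Variables (R : realType) (d : nat).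
Hypothesis hd : (1 <= d)%N.
Local Notation V := 'cV[R]_d.
Implicit Types (x y a b : V) (X Y : set V).
Local Notation mu := (@lebesgue_mu R d).

Lemma box_vol_ge0 a b : 0 <= box_vol a b.
Proof. by apply: prodr_ge0 => i _; rewrite le_max lexx. Qed.

Lemma box_vol_le a b (w : 'I_d -> R) :
  (forall i, 0 <= w i) -> (forall i, b i 0 - a i 0 <= w i) -> box_vol a b <= \prod_i w i.
Proof.
move=> w0 h; apply: ler_prod => i _.
by rewrite le_max lexx /= ge_max w0 h.
Qed.

Lemma box_vol00 a : box_vol a a = 0.
Proof. by rewrite /box_vol (bigD1 (Ordinal hd)) //= subrr maxxx mul0r. Qed.

Lemma mu_ge0 X : (0 <= mu X)%E.
Proof.
apply: le_ereal_inf_tmp => _ [c _ <-].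
by apply: nneseries_ge0 => k _ _; rewrite lee_fin box_vol_ge0.
Qed.

Lemma mu_le_cover X (c : nat -> V * V) : X `<=` \bigcup_k box (c k).1 (c k).2 ->
  (mu X <= \sum_(0 <= k <oo) (box_vol (c k).1 (c k).2)%:E)%E.
Proof. by move=> h; apply: ereal_inf_lbound; exists c. Qed.

Lemma mu_mono X Y : X `<=` Y -> (mu X <= mu Y)%E.
Proof.
move=> XY; apply: le_ereal_inf_tmp => _ [c Yc <-].
by apply: mu_le_cover => x /XY; exact: Yc.
Qed.

Lemma mu_box a b : (mu (box a b) <= (box_vol a b)%:E)%E.
Proof.
(* Degenerate boxes, which are null since [0 < d], pad the cover. *)
pose c k := if k is 0%N then (a, b) else (0 : V, 0 : V).
apply: le_trans (mu_le_cover (c := c) _) _; first by move=> x hx; exists 0%N.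
rewrite (nneseries_split 0%N 1%N); last by move=> k _; rewrite lee_fin box_vol_ge0.
rewrite add0n big_nat1 /= eseries0 ?adde0 //.
by move=> [//|k] _ _ /=; rewrite box_vol00.
Qed.

Lemma mu_cover_eps X (e : R) : 0 < e -> mu X \is a fin_num ->
  exists2 c : nat -> V * V, X `<=` \bigcup_k box (c k).1 (c k).2 &
   (\sum_(0 <= k <oo) (box_vol (c k).1 (c k).2)%:E < mu X + e%:E)%E.
Proof.
move=> e0 fX; have [_ [c Xc <-] h] := lb_ereal_inf_adherent e0 fX.
by exists c.
Qed.

(** Covers that are optimal up to [e / 2 ^ k.+1] of the sets [F k] are rearranged into a single
    sequence of boxes through a bijection between [nat] and [nat * nat]. *)
Lemma mu_bigcup (F : nat -> set V) :
  (mu (\bigcup_k F k) <= \sum_(0 <= k <oo) mu (F k))%E.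
Proof.
have [[i hi]|] := pselect (exists i, mu (F i) = +oo%E).
  rewrite (eseries_pinfty _ _ hi) ?leey // => k _.
  by rewrite -ltNye (lt_le_trans _ (mu_ge0 _)).
rewrite -forallNE => Foo.
have fF k : mu (F k) \is a fin_num.
  by rewrite ge0_fin_numE ?mu_ge0 // ltey; apply/eqP/Foo.
apply/lee_addgt0Pr => e e0.
rewrite (le_trans _ (epsilon_trick _ _ (ltW e0)))//; last by move=> k; exact: mu_ge0.
have e'0 k : 0 < e / (2 ^ k.+1)%:R by rewrite divr_gt0 // ltr0n expn_gt0.
have /choice[c hc] k : exists c : nat -> V * V,
    F k `<=` \bigcup_j box (c j).1 (c j).2 /\
    (\sum_(0 <= j <oo) (box_vol (c j).1 (c j).2)%:E <= mu (F k) + (e / (2 ^ k.+1)%:R)%:E)%E.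
  by have [c h1 /ltW h2] := mu_cover_eps (e'0 k) (fF k); exists c.
pose vol (p : nat * nat) := (box_vol (c p.1 p.2).1 (c p.1 p.2).2)%:E.
have vol0 p : (0 <= vol p)%E by rewrite lee_fin box_vol_ge0.
have /card_esym/ppcard_eqP[f] := card_nat2.
apply: le_trans (mu_le_cover (c := fun k => c (f k).1 (f k).2) _) _.
  move=> x [i _ /(hc i).1[j _ hx]]; exists (f^-1%FUN (i, j)) => //=.
  by rewrite invK ?inE.
rewrite -/(vol _).
have -> : (\sum_(0 <= k <oo) vol (f k) = \esum_(p in setT) vol p)%E.
  rewrite -(@esum_pred_image _ _ vol f xpredT) => [||x y _ _] //.
    by congr esum; rewrite [fun=> _]set_true image_eq.
  by apply: (@inj _ _ setT f); rewrite in_setT.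
have -> : [set: nat * nat] = setT `*`` (fun=> setT) by apply/seteqP; split.
rewrite -(@esum_esum _ _ _ _ _ (fun i j => vol (i, j))) //.
rewrite -nneseries_esumT; last by move=> k; exact: esum_ge0.
apply: lee_nneseries => [k _ _|k _]; first exact: esum_ge0.
by rewrite -nneseries_esumT //; exact: (hc k).2.
Qed.

Lemma mu0 : mu set0 = 0%E.
Proof.
apply/eqP; rewrite eq_le mu_ge0 andbT.
apply: le_trans (mu_mono (Y := box 0 0) _) _ => //.
by apply: le_trans (mu_box _ _) _; rewrite box_vol00.
Qed.

Lemma mu_setU X Y : (mu (X `|` Y) <= mu X + mu Y)%E.
Proof.
pose F k := if k is 0%N then X else if k is 1%N then Y else set0.
apply: le_trans (mu_mono (Y := \bigcup_k F k) _) _.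
  by move=> x [hx|hx]; [exists 0%N|exists 1%N].
apply: le_trans (mu_bigcup _) _.
rewrite (nneseries_split 0%N 2%N); last by move=> k _; exact: mu_ge0.
rewrite add0n big_nat_recr //= big_nat1 /= eseries0 ?adde0 //.
by move=> [|[|k]] //= _ _; rewrite mu0.
Qed.

Lemma mu_le_finite_cover (I : eqType) (s : seq I) (F : I -> set V) X :
  (forall x, X x -> exists2 i, i \in s & F i x) -> (mu X <= \sum_(i <- s) mu (F i))%E.
Proof.
elim: s X => [|i s IH] X h.
  by rewrite big_nil -mu0; apply: mu_mono => x hx; have [j] := h x hx; rewrite in_nil.
rewrite big_cons; apply: le_trans (mu_mono (Y := F i `|` (X `\` F i)) _) _.
  by move=> x hx; have [?|?] := pselect (F i x); [left|right].
apply: le_trans (mu_setU _ _) _; apply: leeD => //; apply: IH => x [/h[j]].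
rewrite in_cons => /orP[/eqP -> //|js] Fj _; by exists j.
Qed.

(** It is enough to control the images of boxes: a cover of [X] is mapped to a cover of its image. *)
Lemma mu_image_le (f : V -> V) (c : R) X : 0 < c ->
  (forall a b, (mu (f @` box a b) <= (c * box_vol a b)%:E)%E) ->
  (mu (f @` X) <= c%:E * mu X)%E.
Proof.
move=> c0 h; rewrite -(ereal_inf_pZl _ c0).
apply: le_ereal_inf_tmp => _ [_ [b Xb <-] <-].
rewrite -nneseriesZl; last by move=> k _; rewrite lee_fin box_vol_ge0.
apply: le_trans (mu_mono (Y := \bigcup_k (f @` box (b k).1 (b k).2)) _) _.
  by move=> _ [x /Xb[k _ hx] <-]; exists k => //; exists x.
apply: le_trans (mu_bigcup _) _.
by apply: lee_nneseries => [k _ _|k _]; [exact: mu_ge0|rewrite -EFinM].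
Qed.

Lemma mu_bounded_fin X (r : R) : (forall x, X x -> `|x| <= r) -> mu X \is a fin_num.
Proof.
move=> h; rewrite ge0_fin_numE ?mu_ge0 //.
pose a : V := const_mx (- r); pose b : V := const_mx r.
apply: le_lt_trans (mu_mono (Y := box a b) _) _.
  move=> x /h hx i; rewrite !mxE -ler_norml; exact: le_trans (norm_coord _ _) hx.
by apply: le_lt_trans (mu_box _ _) _; rewrite ltry.
Qed.

End OuterMeasure.

(** * Linear maps scale the outer measure by the determinant *)

Lemma uniform_grid_step (R : realType) (N : nat) (t h : R) : 0 <= t <= N.+1%:R * h ->
  exists2 s : 'I_N.+1, s%:R * h <= t & t <= s.+1%:R * h.
Proof.
elim: N => [|N IH] /andP[t0 tN].
  by exists ord0; rewrite ?mul0r.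
have [h1|h1] := leP t (N.+1%:R * h).
  have [|s s1 s2] := IH; first by rewrite t0 h1.
  by exists (widen_ord (leqnSn _) s).
by exists ord_max => //=; exact: ltW.
Qed.

(** The product is a polynomial in [h], hence continuous at [0]. *)
Lemma prod_affine_eps (R : realType) (I : finType) (P : pred I) (w c : I -> R) (e : R) :
  0 < e -> exists2 eta, 0 < eta & forall h, 0 <= h <= eta ->
    \prod_(i | P i) (w i + c i * h) <= \prod_(i | P i) w i + e.
Proof.
move=> e0.
pose p : {poly R} := \prod_(i | P i) ((w i)%:P + (c i)%:P * 'X).
have pE h : p.[h] = \prod_(i | P i) (w i + c i * h).
  by rewrite horner_prod; apply: eq_bigr => i _; rewrite !hornerE.
have /cvgrPdist_le /(_ _ e0) /nbhs_ballP[r /= r0 hr] : p.[x] @[x --> 0] --> p.[0] by exact: continuous_horner.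
exists (r / 2); first by rewrite divr_gt0.
move=> h /andP[h0 hr2].
have := hr h; rewrite -ball_normE /= sub0r normrN ger0_norm // => /(_ _).
rewrite !pE => /(_ _)/ler_normlP[|].
  by apply: le_lt_trans hr2 _; rewrite ltr_pdivrMr // ltr_pMr // ltr1n.
have -> : \prod_(i | P i) (w i + c i * 0) = \prod_(i | P i) w i.
  by apply: eq_bigr => i _; rewrite mulr0 addr0.
by rewrite lerBlDr opprB; lra.
Qed.

Section Scaling.
Variables (R : realType) (d : nat).
Hypothesis hd : (1 <= d)%N.
Local Notation V := 'cV[R]_d.
Implicit Types (x y a b v : V) (k : 'I_d) (X Y : set V) (B C : 'M[R]_d).
Local Notation mu := (@lebesgue_mu R d).

Lemma mu_translate X v : mu [set x + v | x in X] = mu X.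
Proof.
have le Y (w : V) : (mu [set (x + w)%R | x in Y] <= mu Y)%E.
  rewrite -[leRHS]mul1e; apply: (mu_image_le (c := 1)) => // a b; rewrite mul1r.
  apply: le_trans (mu_mono (Y := box (a + w)%R (b + w)%R) _) _.
    by move=> _ [x hx <-] i; rewrite !mxE !lerD2r.
  apply: le_trans (mu_box hd _ _) _; rewrite lee_fin le_eqVlt; apply/orP; left.
  by apply/eqP/eq_bigr => i _; rewrite !mxE; congr Num.max; ring.
apply/eqP; rewrite eq_le le /=.
apply: le_trans (mu_mono _) (le [set x + v | x in X] (- v)).
by move=> x hx; exists (x + v); rewrite ?addrK //; exists x.
Qed.

(** Stated as an inequality, which passes from boxes to all sets and is stable under products; for
    invertible [B] the reverse inequality is that of the inverse of [B]. *)
Definition scales_by_det B := forall X, (mu (mulmx B @` X) <= `|\det B|%:E * mu X)%E.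

Lemma scales_by_detM B C : scales_by_det B -> scales_by_det C -> scales_by_det (B *m C).
Proof.
move=> hB hC X; rewrite det_mulmx normrM EFinM -muleA.
apply: le_trans (mu_mono (Y := mulmx B @` (mulmx C @` X)) _) _.
  by move=> _ [x hx <-]; exists (C *m x); [exists x|rewrite mulmxA].
apply: le_trans (hB _) _; apply: lee_wpmul2l; first by rewrite lee_fin.
exact: hC.
Qed.

Lemma scales_by_det1 : scales_by_det 1%:M.
Proof.
move=> X; rewrite det1 normr1 mul1e; apply: mu_mono => _ [x hx <-].
by rewrite mul1mx.
Qed.

Lemma scales_by_det_tperm i j : scales_by_det (tperm_mx i j).
Proof.
move=> X; have dE : `|\det (tperm_mx i j : 'M[R]_d)| = 1.
  by rewrite det_perm normrX normrN1 expr1n.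
rewrite dE; apply: mu_image_le => // a b; rewrite mul1r.
pose f (x : V) : V := \col_k x (tperm i j k) 0.
have fE x : tperm_mx i j *m x = f x.
  by apply/colP => k; rewrite /tperm_mx -row_permE !mxE.
apply: le_trans (mu_mono (Y := box (f a) (f b)) _) _.
  by move=> _ [x hx <-] k; rewrite fE !mxE.
apply: le_trans (mu_box hd _ _) _; rewrite lee_fin /box_vol.
rewrite [leRHS](reindex_inj (@perm_inj _ (tperm i j))) /=.
by rewrite le_eqVlt; apply/orP; left; apply/eqP/eq_bigr => k _; rewrite !mxE.
Qed.

(** The elementary matrices of Gaussian elimination by columns: multiplying by one of them shears
    the space along [v] and dilates the [k]-th axis. *)
Definition column_mx (k : 'I_d) (v : V) : 'M[R]_d :=
  \matrix_(i, j) if j == k then v i 0 else (i == j)%:R.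

(** The cofactors along column [k] do not involve [v]: they are those of the identity matrix. *)
Lemma det_column_mx k v : \det (column_mx k v) = v k 0.
Proof.
rewrite (expand_det_col _ k).
have adj1 : \adj (1%:M : 'M[R]_d) = 1%:M.
  by have := mul_mx_adj (1%:M : 'M[R]_d); rewrite mul1mx det1.
transitivity (\sum_i v i 0 * (\adj (1%:M : 'M[R]_d)) k i).
  apply: eq_bigr => i _; rewrite !mxE eqxx; congr (_ * _); rewrite /cofactor.
  congr (_ * \det _); apply/matrixP => p q; rewrite !mxE.
  by rewrite eq_sym (negbTE (neq_lift _ _)).
rewrite adj1 (bigD1 k) //= !mxE eqxx mulr1 big1 ?addr0 // => i ik.
by rewrite !mxE eq_sym (negbTE ik) mulr0.
Qed.

Lemma mul_column_mx k v x :
  column_mx k v *m x = \col_i (if i == k then v k 0 * x k 0 else x i 0 + v i 0 * x k 0).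
Proof.
apply/colP => i; rewrite !mxE (bigD1 k) //= !mxE eqxx.
case: (eqVneq i k) => [->|ik].
  by rewrite big1 ?addr0 // => j jk; rewrite !mxE (negbTE jk) eq_sym (negbTE jk) mul0r.
rewrite addrC (bigD1 i) //= !mxE (negbTE ik) eqxx mul1r; congr (_ + _).
rewrite big1 ?addr0 // => j /andP[jk ji].
by rewrite !mxE (negbTE jk) eq_sym (negbTE ji) mul0r.
Qed.

(** A box is cut into slices of thickness [h] orthogonal to the [k]-th axis. The image of a slice is
    contained in a box whose sides exceed those of the slice, in the other directions, by at most
    a multiple of [h]; the excess of the total volume vanishes with [h]. *)
Lemma scales_by_det_column k v : v k 0 != 0 -> scales_by_det (column_mx k v).
Proof.
move=> vk0 X; rewrite det_column_mx; apply: mu_image_le; first by rewrite normr_gt0.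
move=> a b.
have [[i bi]|] := pselect (exists i, b i 0 < a i 0).
  rewrite (_ : _ @` _ = set0) ?mu0 ?lee_fin ?mulr_ge0 ?box_vol_ge0 //.
  apply/seteqP; split => // y [x /(_ i) /andP[h1 h2] _].
  by have := le_lt_trans (le_trans h1 h2) bi; rewrite ltxx.
move=> nba; have ab i : 0 <= b i 0 - a i 0.
  by rewrite subr_ge0 leNgt; apply/negP => h; apply: nba; exists i.
have volE : box_vol a b = \prod_i (b i 0 - a i 0).
  by apply: eq_bigr => i _; rewrite max_r.
apply/lee_addgt0Pr => e e0; rewrite -EFinD volE.
have wk0 := ab k.
set wk := b k 0 - a k 0 in wk0.
have e'0 : 0 < e / (`|v k 0| * wk + 1) by rewrite divr_gt0 // ltr_wpDl // mulr_ge0.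
have [eta eta0 heta] := prod_affine_eps (fun i => i != k) (fun i => b i 0 - a i 0) (fun i => `|v i 0|) e'0.
pose N := Num.truncn (wk / eta).
have hN : wk / eta < N.+1%:R by exact: truncnS_gt.
pose h := wk / N.+1%:R.
have h0 : 0 <= h by rewrite divr_ge0.
have hh : h <= eta.
  by rewrite ler_pdivrMr ?ltr0n // mulrC -ler_pdivrMr //; exact: ltW.
(* [c s] is the midpoint of the [s]-th slice. *)
pose c (s : 'I_N.+1) := a k 0 + s%:R * h + h / 2.
pose a' s : V := \col_i (if i == k then v k 0 * c s - `|v k 0| * (h / 2)
   else a i 0 + v i 0 * c s - `|v i 0| * (h / 2)).
pose b' s : V := \col_i (if i == k then v k 0 * c s + `|v k 0| * (h / 2)
   else b i 0 + v i 0 * c s + `|v i 0| * (h / 2)).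
apply: le_trans (mu_le_finite_cover hd (s := index_enum 'I_N.+1) (F := fun s => box (a' s) (b' s)) _) _.
  move=> _ [x hx <-].
  have [|s s1 s2] := @uniform_grid_step _ N (x k 0 - a k 0) h.
    have := hx k; rewrite /h mulrCA divff ?pnatr_eq0 // mulr1 /wk.
    by move=> /andP[? ?]; apply/andP; split; lra.
  exists s; first exact: mem_index_enum.
  have xc : `|x k 0 - c s| <= h / 2.
    by rewrite ler_norml /c; move: s1 s2; rewrite -natr1 mulrDl mul1r => *; apply/andP; split; lra.
  have vx i : `|v i 0 * x k 0 - v i 0 * c s| <= `|v i 0| * (h / 2).
    by rewrite -mulrBr normrM ler_wpM2l.
  move=> i; rewrite mul_column_mx !mxE.
  have := vx i; have /andP[] := hx i.
  case: (eqVneq i k) => [->|ik]; rewrite ler_norml => h1 h2 /andP[h3 h4]; apply/andP; split; lra.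
apply: (@le_trans _ _ (\sum_(s <- index_enum 'I_N.+1) (`|v k 0| * h * \prod_(i | i != k) (b i 0 - a i 0 + `|v i 0| * h))%:E)%E).
  apply: lee_sum => s _; apply: le_trans (mu_box hd _ _) _; rewrite lee_fin.
  pose w i := if i == k then `|v k 0| * h else b i 0 - a i 0 + `|v i 0| * h.
  have -> : `|v k 0| * h * \prod_(i | i != k) (b i 0 - a i 0 + `|v i 0| * h) = \prod_i w i.
    rewrite [RHS](bigD1 k) //= /w eqxx; congr (_ * _); apply: eq_bigr => i ik.
    by rewrite (negbTE ik).
  apply: box_vol_le => i.
    by rewrite /w; case: eqP => _; [exact: mulr_ge0|apply: addr_ge0 (ab i) _; exact: mulr_ge0].
  by rewrite /w !mxE; case: (i =P k) => _; lra.
rewrite sumEFin lee_fin sumr_const card_ord -[leLHS]mulr_natl.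
have -> : N.+1%:R * (`|v k 0| * h * \prod_(i < d | i != k) (b i 0 - a i 0 + `|v i 0| * h))
  = (`|v k 0| * wk) * \prod_(i < d | i != k) (b i 0 - a i 0 + `|v i 0| * h).
  by rewrite !mulrA; congr (_ * _); rewrite -(mulrA N.+1%:R) mulrC mulKf ?pnatr_eq0.
apply: le_trans (ler_wpM2l _ (heta h _)) _; rewrite ?mulr_ge0 ?h0 //.
rewrite mulrDr [in leRHS](bigD1 k) //= [X in _ <= X + _]mulrA lerD2l mulrCA.
rewrite -[leRHS]mulr1 ler_wpM2l ?(ltW e0) // ler_pdivrMr ?mul1r ?lerDl //.
by rewrite ltr_wpDl // mulr_ge0.
Qed.

(** Gaussian elimination by columns. If the first [m] columns of [B] are those of the identity, then,
    after a transposition of rows, [B] is an elementary matrix times a matrix whose first [m.+1]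
    columns are those of the identity. *)
Lemma scales_by_det_unit B : B \in unitmx -> scales_by_det B.
Proof.
suff H (k m : nat) : (m + k)%N = d -> forall B, B \in unitmx ->
    (forall i j : 'I_d, (j < m)%N -> B i j = (i == j)%:R) -> scales_by_det B.
  by move=> Bu; apply: (H d 0%N).
elim: k m => [|k IH] m mk {}B Bu Bid.
  rewrite (_ : B = 1%:M); first exact: scales_by_det1.
  by apply/matrixP => i j; rewrite !mxE Bid //; have := ltn_ord j; lia.
have md : (m < d)%N by lia.
pose j0 := Ordinal md.
(* Without a pivot, column [m] would be a combination of the previous, unit, columns. *)
have [i0 mi0 Bi0] : exists2 i0 : 'I_d, (m <= i0)%N & B i0 j0 != 0.
  apply: contrapT => hn.
  have Bz (i : 'I_d) : (m <= i)%N -> B i j0 = 0.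
    by move=> mi; apply/eqP/negPn/negP => h; apply: hn; exists i.
  pose x : V := \col_j (if (j < m)%N then - B j j0 else (j == j0)%:R).
  have Bx : B *m x = 0.
    apply/colP => i; rewrite !mxE (bigD1 j0) //= !mxE ltnn eqxx mulr1.
    have [im|im] := ltnP i m.
      rewrite (bigD1 i) /=; last by rewrite -val_eqE /= ltn_eqF.
      rewrite !mxE im (Bid i i) // eqxx mul1r addrA addrN add0r big1 // => j /andP[jj ji].
      rewrite !mxE; case: ifP => jm; last by rewrite (negbTE jj) mulr0.
      by rewrite Bid // eq_sym (negbTE ji) mul0r.
    rewrite Bz // add0r big1 // => j jj; rewrite !mxE.
    case: ifP => jm; last by rewrite (negbTE jj) mulr0.
    by rewrite Bid // -val_eqE /= gtn_eqF ?mul0r // (leq_trans jm).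
  have /colP /(_ j0) : x = 0 by rewrite -[x](mulKmx Bu) Bx mulmx0.
  by rewrite !mxE ltnn eqxx => /eqP; rewrite oner_eq0.
pose P : 'M[R]_d := tperm_mx i0 j0.
pose B' := P *m B.
have B'E i j : B' i j = B (tperm i0 j0 i) j by rewrite /B' /P /tperm_mx -row_permE !mxE.
have PP : P *m P = 1%:M by rewrite /P /tperm_mx -perm_mxM tperm2 perm_mx1.
have B'id (i j : 'I_d) : (j < m)%N -> B' i j = (i == j)%:R.
  move=> jm; rewrite B'E Bid //; congr (nat_of_bool _)%:R.
  have ji : (j == i0) = false by rewrite -val_eqE /= ltn_eqF // (leq_trans jm).
  have jj : (j == j0) = false by rewrite -val_eqE /= ltn_eqF.
  by case: tpermP => [->|->|]; rewrite ?[_ == j]eq_sym ?ji ?jj.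
pose v := col j0 B'.
have vj0 : v j0 0 != 0 by rewrite mxE B'E tpermR.
pose E := column_mx j0 v.
have Eu : E \in unitmx by rewrite unitmxE det_column_mx unitfE.
have Pu : P \in unitmx by have := mulmx1_unit PP => -[].
have B'u : B' \in unitmx by rewrite unitmx_mul Pu.
have -> : B = P *m (E *m (invmx E *m B')) by rewrite mulKVmx // /B' mulmxA PP mul1mx.
apply: scales_by_detM; first exact: scales_by_det_tperm.
apply: scales_by_detM; first exact: scales_by_det_column.
apply: (IH m.+1); first by lia.
  by rewrite unitmx_mul unitmx_inv Eu.
move=> i j; rewrite ltnS => jm.
have cE : col j B' = col j E.
  apply/colP => p; rewrite [LHS]mxE [RHS]mxE [RHS]mxE [v _ _]mxE; case: eqP => [->|/eqP jj]; first by [].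
  by rewrite B'id // ltn_neqAle jm andbT.
have /colP /(_ i) : col j (invmx E *m B') = col j 1%:M.
  have colM (M N : 'M[R]_d) : col j (M *m N) = M *m col j N by rewrite !colE mulmxA.
  by rewrite -(mulVmx Eu) [LHS]colM [RHS]colM cE.
by rewrite !mxE.
Qed.

End Scaling.

(** * Finite box covers and unit cells *)

Lemma sum_prod_affine_eps (R : realType) (J : Type) (s : seq J) (I : finType)
    (w c : J -> I -> R) (e : R) :
  0 < e -> exists2 eta, 0 < eta & forall h, 0 <= h <= eta ->
    \sum_(j <- s) \prod_i (w j i + c j i * h) <= \sum_(j <- s) \prod_i w j i + e.
Proof.
elim: s e => [|j s IH] e e0.
  by exists 1 => // h _; rewrite !big_nil add0r ltW.
have e2 : 0 < e / 2 by rewrite divr_gt0.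
have [u u0 hu] := IH _ e2.
have [v v0 hv] := prod_affine_eps xpredT (w j) (c j) e2.
exists (Num.min u v); first by rewrite lt_min u0.
move=> h /andP[h0]; rewrite le_min => /andP[h1 h2]; rewrite !big_cons.
have := hu h; have := hv h; rewrite h0 h1 h2 => /(_ isT) ? /(_ isT) ?.
lra.
Qed.

Section FiniteCovers.
Variables (R : realType) (d : nat).
Hypothesis hd : (1 <= d)%N.
Local Notation V := 'cV[R]_d.
Implicit Types (x y a b v : V) (X Y : set V) (s : seq (V * V)).
Local Notation mu := (@lebesgue_mu R d).

Definition widen (h : R) (p : V * V) : V * V := (p.1 - const_mx h, p.2 + const_mx h).

Lemma widen_vol_eps s (e : R) : 0 < e -> exists2 eta, 0 < eta & forall h, 0 <= h <= eta ->
  \sum_(p <- s) box_vol (widen h p).1 (widen h p).2 <= \sum_(p <- s) box_vol p.1 p.2 + e.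
Proof.
move=> e0.
have [eta eta0 h] := sum_prod_affine_eps s
  (fun p i => Num.max 0 (p.2 i 0 - p.1 i 0)) (fun _ _ => 2) e0.
exists eta => // t ht; apply: le_trans (h t ht).
have /andP[t0 _] := ht.
apply: ler_sum => p _; apply: box_vol_le => i.
  by rewrite addr_ge0 ?le_max ?lexx // mulr_ge0.
rewrite !mxE; have : p.2 i 0 - p.1 i 0 <= Num.max 0 (p.2 i 0 - p.1 i 0).
  by rewrite le_max lexx orbT.
lra.
Qed.

Lemma open_box a b : open [set x : V | forall i, a i 0 < x i 0 < b i 0].
Proof.
rewrite openE => x hx; rewrite /interior /=.
exists (fun i j => [set t : R | a i 0 < t < b i 0]).
  move=> i j; rewrite (ord1 j); have /andP[h1 h2] := hx i.
  have h : nbhs (x i 0) ([set t : R | a i 0 < t] `&` [set t : R | t < b i 0]).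
    by apply: filterI; [exact: open_nbhs_nbhs (conj (@open_gt _ _) h1)
                       | exact: open_nbhs_nbhs (conj (@open_lt _ _) h2)].
  by apply: filterS h => t [/= -> ->].
by move=> y hy i; exact: (hy i 0).
Qed.

Lemma trmx_continuous m n : continuous (@trmx R m n).
Proof.
move=> x U [P hP PU]; exists (fun i j => P j i) => [i j|y hy].
  by have := hP j i; rewrite mxE.
by apply: PU => i j; rewrite mxE; exact: hy.
Qed.

Lemma box_compact a b : compact (box a b).
Proof.
have -> : box a b = (@trmx R 1 d) @`
    [set v : 'rV[R]_d | forall i, `[a i 0, b i 0]%classic (v ord0 i)].
  apply/seteqP; split => [x hx|_ [v hv <-]] /=.
    by exists x^T; rewrite ?trmxK // => i; rewrite mxE /= in_itv /= hx.
  by move=> i; have := hv i; rewrite /= in_itv /= mxE.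
apply: continuous_compact.
  by apply: continuous_subspaceT => x; exact: trmx_continuous.
apply: (@rV_compact R d (fun i => `[a i 0, b i 0]%classic)) => i.
exact: segment_compact.
Qed.

(** Outer regularity on compact sets: the boxes of a nearly optimal cover are widened to open boxes,
    at a total cost [e], and compactness leaves finitely many of them. *)
Lemma compact_finite_cover X (delta : R) : compact X -> (mu X < delta%:E)%E ->
  exists2 s : seq (V * V), (forall x, X x -> exists2 p, p \in s & forall i, p.1 i 0 < x i 0 < p.2 i 0)
  & \sum_(p <- s) box_vol p.1 p.2 < delta.
Proof.
move=> cX Xd.
have fX : mu X \is a fin_num by rewrite ge0_fin_numE ?mu_ge0 // (lt_trans Xd) ?ltry.
pose e := (delta - fine (mu X)) / 2.
have mX : mu X = (fine (mu X))%:E by rewrite fineK.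
have e0 : 0 < e by rewrite divr_gt0 // subr_gt0 -lte_fin -mX.
have [c Xc cs] := mu_cover_eps e0 fX.
have e'0 k : 0 < e / (2 ^ k.+1)%:R by rewrite divr_gt0 // ltr0n expn_gt0.
have /choice[eta heta] k : exists eta, 0 < eta /\
    box_vol (widen eta (c k)).1 (widen eta (c k)).2
      <= box_vol (c k).1 (c k).2 + e / (2 ^ k.+1)%:R.
  have [t t0 h] := widen_vol_eps [:: c k] (e'0 k).
  by exists t; split => //; have := h t; rewrite !big_seq1 lexx (ltW t0); exact.
pose w k := widen (eta k) (c k).
pose f k : set V := [set x | forall i, (w k).1 i 0 < x i 0 < (w k).2 i 0].
move: cX; rewrite compact_cover => /(_ nat setT f) [||D _ hD].
- by move=> k _; exact: open_box.
- move=> x /Xc[k _ hx]; exists k => // i; have /andP[h1 h2] := hx i.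
  have [h3 _] := heta k.
  by rewrite !mxE; apply/andP; split; lra.
pose N := (\max_(k <- D) k).+1.
exists [seq w k | k <- iota 0 N].
  move=> x /hD[k /= kD hx].
  have kN : k \in iota 0 N.
    by rewrite mem_iota add0n /N ltnS (@leq_bigmax_seq _ (enum_fset D) xpredT (fun k => k) k).
  by exists (w k); first exact: (map_f w kN).
rewrite -lte_fin big_map -sumEFin.
apply: le_lt_trans (_ : \sum_(0 <= k <oo) ((box_vol (c k).1 (c k).2)%:E + (e / (2 ^ k.+1)%:R)%:E) < _)%E.
  apply: le_trans (nneseries_lim_ge N _); last first.
    by move=> k _ _; rewrite -EFinD lee_fin addr_ge0 ?box_vol_ge0 // ltW.
  rewrite /index_iota subn0; apply: lee_sum => k _.
  by rewrite -EFinD lee_fin; exact: (heta k).2.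
apply: le_lt_trans (epsilon_trick _ _ (ltW e0)) _.
  by move=> k; rewrite lee_fin box_vol_ge0.
apply: lt_le_trans (_ : mu X + e%:E + e%:E <= _)%E.
  by rewrite lteD2rE.
by rewrite mX -!EFinD lee_fin /e; lra.
Qed.

Lemma mu_le_finite_boxes s X : (forall x, X x -> exists2 p, p \in s & box p.1 p.2 x) ->
  (mu X <= (\sum_(p <- s) box_vol p.1 p.2)%:E)%E.
Proof.
move=> h; apply: le_trans (mu_le_finite_cover hd (s := s) (F := fun p => box p.1 p.2) h) _.
by rewrite -sumEFin; apply: lee_sum => p _; exact: mu_box.
Qed.

Definition thicken X (eta : R) : set V := [set y | exists2 x, X x & `|y - x| <= eta].

(** The outer measure is upper semicontinuous along neighbourhoods of a compact set, because a small
    common widening of finitely many open boxes absorbs the neighbourhood. *)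
Lemma mu_thicken X (delta : R) : compact X -> (mu X < delta%:E)%E ->
  exists2 eta, 0 < eta & (mu (thicken X eta) < delta%:E)%E.
Proof.
move=> cX /(compact_finite_cover cX)[s hs sd].
have e0 : 0 < (delta - \sum_(p <- s) box_vol p.1 p.2) / 2 by rewrite divr_gt0 // subr_gt0.
have [eta eta0 heta] := widen_vol_eps s e0.
exists eta => //.
have {heta} := heta eta; rewrite lexx (ltW eta0) => /(_ isT) heta.
apply: le_lt_trans (mu_le_finite_boxes (s := [seq widen eta p | p <- s]) _) _.
  move=> y [x /hs[p ps hp] yx]; exists (widen eta p); first exact: map_f.
  move=> i; have /andP[h1 h2] := hp i; rewrite !mxE.
  have := le_trans (norm_coord (y - x) i) yx.
  by rewrite !mxE ler_norml => /andP[h3 h4]; apply/andP; split; lra.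
by rewrite big_map lte_fin; lra.
Qed.

Lemma card_nat_interval (T : finType) (G : {set T}) (n : T -> nat) (al be : R) :
  injective n -> (forall g, g \in G -> al <= (n g)%:R <= be) ->
  #|G|%:R <= Num.max 0 (be - al) + 1.
Proof.
move=> ninj h.
have [->|[g0 g0G]] := set_0Vmem G.
  by rewrite cards0 addr_ge0 // le_max lexx.
case: (arg_minnP n g0G) => m mG mmin.
have w0 : 0 <= be - al by have /andP[? ?] := h _ g0G; lra.
rewrite max_r //; pose t := Num.truncn (be - al).
apply: (@le_trans _ _ (t.+1)%:R); last by rewrite -natr1 lerD2r truncn_le.
rewrite ler_nat cardE -(size_map n) -(size_iota (n m) t.+1).
apply: uniq_leq_size; first by rewrite (map_inj_uniq ninj) enum_uniq.
move=> u /mapP[g]; rewrite mem_enum => gG ->{u}.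
rewrite mem_iota mmin //= addnS ltnS -leq_subLR.
rewrite /t truncn_ge_nat // natrB ?mmin //.
have /andP[? ?] := h _ gG; have /andP[? ?] := h _ mG; lra.
Qed.

Definition cell_corner K (o : V) (f : {ffun 'I_d -> 'I_K}) : V := \col_i (o i 0 + (f i)%:R).
(** The closed unit cubes of a finite integer grid; the corner [o] is an arbitrary real point so that
    the index set can be a finite type. *)
Definition cell K (o : V) (f : {ffun 'I_d -> 'I_K}) : set V :=
  box (cell_corner o f) (cell_corner o f + const_mx 1).

(** The cells contain [p ^ d] grid points of mesh [1 / p] each, all distinct, and a box with sides
    [w i] contains at most [\prod_i (p * w i + 1)] of them. *)
Lemma grid_count K p (o : V) (Z : {set {ffun 'I_d -> 'I_K}}) s :
  (0 < p)%N -> (forall x f, f \in Z -> cell o f x -> exists2 q, q \in s & box q.1 q.2 x) ->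
  (#|Z| * p ^ d)%:R <= \sum_(q <- s) \prod_i (p%:R * Num.max 0 (q.2 i 0 - q.1 i 0) + 1) :> R.
Proof.
move=> p0 hs.
have pR : 0 < p%:R :> R by rewrite ltr0n.
pose T := {ffun 'I_d -> 'I_K * 'I_p}.
pose n (t : 'I_K * 'I_p) : nat := (t.1 * p + t.2)%N.
have ninj : injective n.
  move=> [a b] [a' b']; rewrite /n /= => e.
  have e1 : a = a' :> nat.
    by have := congr1 (divn^~ p) e; rewrite !divnMDl // !divn_small ?addn0.
  have e2 : b = b' :> nat by move: e; rewrite e1 => /addnI.
  by congr (_, _); exact: val_inj.
pose pt (t : T) : V := \col_i (o i 0 + (n (t i))%:R / p%:R).
pose B (q : V * V) : {set T} := [set t | `[< box q.1 q.2 (pt t) >]]%SET.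
pose H : {set T} := [set t : T | [ffun i => (t i).1] \in Z]%SET.
have HZ : (#|Z| * p ^ d <= #|H|)%N.
  pose j (fg : {ffun 'I_d -> 'I_K} * {ffun 'I_d -> 'I_p}) : T := [ffun i => (fg.1 i, fg.2 i)].
  have jinj : injective j.
    move=> [f g] [f' g'] /ffunP e; congr (_, _); apply/ffunP => i.
      by have := e i; rewrite !ffunE => -[].
    by have := e i; rewrite !ffunE => -[].
  rewrite -[p in (p ^ _)%N]card_ord -[d in (_ ^ d)%N]card_ord -card_ffun -cardsT -cardsX.
  rewrite -(card_imset _ jinj); apply: subset_leq_card; apply/fintype.subsetP => t0 /imsetP[[f g] fg ->{t0}].
  move: fg; rewrite !inE andbT; congr (_ \in Z).
  by apply/ffunP => i; rewrite !ffunE.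
have HB : (#|H| <= \sum_(q <- s) #|B q|)%N.
  have : {subset H <= (\bigcup_(q <- s) B q)%SET}.
    move=> t; rewrite !inE => tZ.
    have /hs : [ffun i => (t i).1] \in Z := tZ.
    move=> /(_ (pt t)) [|q qs hq].
      move=> i; rewrite !mxE ffunE /n natrD natrM mulrDl mulfK ?gt_eqF //.
      have h1 : 0 <= (t i).2%:R / p%:R :> R by rewrite divr_ge0.
      have h2 : (t i).2%:R / p%:R <= 1 :> R by rewrite ler_pdivrMr // mul1r ler_nat ltnW.
      by apply/andP; split; lra.
    by rewrite (big_rem q) //= !inE; apply/orP; left; apply/asboolP.
  move=> /fintype.subsetP/subset_leq_card/leq_trans; apply.
  elim: s {hs} => [|q s IH]; first by rewrite !big_nil cards0.
  by rewrite !big_cons (leq_trans (leq_card_setU _ _)) // leq_add2l.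
apply: le_trans (_ : \sum_(q <- s) #|B q|%:R <= _).
  by rewrite -natr_sum ler_nat (leq_trans HZ).
apply: ler_sum => q _.
pose G i : {set 'I_K * 'I_p} :=
  [set t | q.1 i 0 <= o i 0 + (n t)%:R / p%:R <= q.2 i 0]%SET.
have BG : (#|B q| <= \prod_i #|G i|)%N.
  have -> : (\prod_i #|G i| = #|(family (fun i => mem (G i)) : simpl_pred T)|)%N.
    by rewrite card_family foldrE big_map big_enum.
  apply: subset_leq_card; apply/fintype.subsetP => t; rewrite inE => /asboolP hq.
  by apply/familyP => i; rewrite inE; have := hq i; rewrite mxE.
apply: le_trans (_ : (\prod_i #|G i|)%:R <= _); first by rewrite ler_nat.
rewrite natr_prod; apply: ler_prod => i _; rewrite ler0n /=.
apply: le_trans (@card_nat_interval _ (G i) n (p%:R * (q.1 i 0 - o i 0)) (p%:R * (q.2 i 0 - o i 0)) ninj _) _.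
  move=> t; rewrite inE => /andP[h1 h2].
  have e : p%:R * ((n t)%:R / p%:R) = (n t)%:R :> R by rewrite mulrC divfK ?gt_eqF.
  by rewrite -e !ler_pM2l //; apply/andP; split; lra.
rewrite lerD2r -mulrBr -[X in Num.max X _](mulr0 p%:R) -maxr_pMr ?ler0n //.
by rewrite le_eqVlt; apply/orP; left; apply/eqP; congr (_ * Num.max _ _); ring.
Qed.

(** The lower bound on the outer measure: for a cover by finitely many boxes, count the grid points
    of mesh [1 / p] as in [grid_count], divide by [p ^ d], and let [p] grow. *)
Lemma card_cells_le K (o : V) (Z : {set {ffun 'I_d -> 'I_K}}) X :
  (forall f, f \in Z -> cell o f `<=` X) -> (#|Z|%:R%:E <= mu X)%E.
Proof.
move=> ZX.
pose U : set V := \big[setU/set0]_(f <- enum Z) cell o f.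
have UP x f : f \in Z -> cell o f x -> U x.
  by move=> fZ hx; rewrite /U -bigcup_seq; exists f => //=; rewrite mem_enum.
have UX : U `<=` X.
  by rewrite /U -bigcup_seq => x [f /=]; rewrite mem_enum => fZ; exact: ZX.
have cU : compact U by apply: bigsetU_compact => f _; exact: box_compact.
apply: le_trans (mu_mono UX); rewrite leNgt; apply/negP => /(compact_finite_cover cU)[s hs sd].
pose e := (#|Z|%:R - \sum_(p <- s) box_vol p.1 p.2) / 2.
have e0 : 0 < e by rewrite divr_gt0 // subr_gt0.
have [eta eta0 heta] := sum_prod_affine_eps s
  (fun p i => Num.max 0 (p.2 i 0 - p.1 i 0)) (fun _ _ => 1) e0.
pose p := (Num.truncn eta^-1).+1.
have pR : 0 < p%:R :> R by rewrite ltr0n.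
have hp : p%:R^-1 <= eta by rewrite invf_ple ?posrE // ltW // truncnS_gt.
have := heta p%:R^-1; rewrite hp invr_ge0 ler0n => /(_ isT).
apply/negP; rewrite -ltNge.
apply: lt_le_trans (_ : #|Z|%:R <= _); first by rewrite -/(box_vol _ _) /e; lra.
have := @grid_count K p o Z s isT _.
have -> : \sum_(q <- s) \prod_i (p%:R * Num.max 0 (q.2 i 0 - q.1 i 0) + 1) =
    p%:R ^+ d * \sum_(q <- s) \prod_i (Num.max 0 (q.2 i 0 - q.1 i 0) + 1 / p%:R) :> R.
  rewrite mulr_sumr; apply: eq_bigr => q _.
  rewrite -[d in _ ^+ d]card_ord -prodr_const -big_split /=; apply: eq_bigr => i _.
  by rewrite mulrDr mul1r divff ?gt_eqF.
rewrite natrM natrX mulrC ler_pM2l ?exprn_gt0 // mul1r; apply.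
move=> x f fZ /(UP _ _ fZ) /hs[q qs hq]; exists q => // i.
by have /andP[/ltW -> /ltW ->] := hq i.
Qed.

Definition subcell K (o : V) (f : {ffun 'I_d -> 'I_K}) N (g : {ffun 'I_d -> 'I_N.+1}) : set V :=
  let a := \col_i (o i 0 + (f i)%:R + (g i)%:R * N.+1%:R^-1) in box a (a + const_mx N.+1%:R^-1).

Lemma subcell_cover K (o : V) (f : {ffun 'I_d -> 'I_K}) N x : cell o f x ->
  exists g : {ffun 'I_d -> 'I_N.+1}, subcell o f g x.
Proof.
move=> hx; have /choice[g hg] (i : 'I_d) : exists s : 'I_N.+1,
    s%:R * N.+1%:R^-1 <= x i 0 - (o i 0 + (f i)%:R) <= s.+1%:R * N.+1%:R^-1.
  have [|s s1 s2] := @uniform_grid_step _ N (x i 0 - (o i 0 + (f i)%:R)) N.+1%:R^-1.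
    rewrite divff ?pnatr_eq0 //; have := hx i; rewrite !mxE => /andP[? ?].
    by apply/andP; split; lra.
  by exists s; rewrite s1.
exists (finfun g) => i; have := hg i; rewrite !mxE ffunE.
have -> : (g i).+1%:R * N.+1%:R^-1 = (g i)%:R * N.+1%:R^-1 + N.+1%:R^-1 :> R.
  by rewrite -[(g i).+1%:R]natr1 mulrDl mul1r.
by move: (N.+1%:R^-1 : R) => t /andP[? ?]; apply/andP; split; lra.
Qed.

Lemma subcell_dist K (o : V) (f : {ffun 'I_d -> 'I_K}) N (g : {ffun 'I_d -> 'I_N.+1}) x y :
  subcell o f g x -> subcell o f g y -> `|x - y| <= N.+1%:R^-1.
Proof.
move=> hx hy; apply: norm_le => [|i]; first by rewrite invr_ge0.
have := hx i; have := hy i; rewrite !mxE.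
move: (N.+1%:R^-1 : R) => t.
by move=> /andP[? ?] /andP[? ?]; rewrite ler_norml; apply/andP; split; lra.
Qed.

Lemma mu_subcell K (o : V) (f : {ffun 'I_d -> 'I_K}) N (g : {ffun 'I_d -> 'I_N.+1}) :
  (mu (subcell o f g) <= ((N.+1%:R ^+ d)^-1)%:E)%E.
Proof.
apply: le_trans (mu_box hd _ _) _; rewrite lee_fin.
apply: le_trans (box_vol_le (w := fun=> N.+1%:R^-1) _ _) _.
- by move=> i; rewrite invr_ge0.
- by move=> i; rewrite !mxE; move: (N.+1%:R^-1 : R) => t; lra.
by rewrite prodr_const card_ord exprVn.
Qed.

(** Each cell contributes [N.+1 ^ d - 1] of its [N.+1 ^ d] subcells to a cover of [X]. *)
Lemma mu_le_missing_subcells K (o : V) (Z : {set {ffun 'I_d -> 'I_K}}) N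
    (g : {ffun 'I_d -> 'I_K} -> {ffun 'I_d -> 'I_N.+1}) X :
  (forall x, X x -> exists2 f, f \in Z & cell o f x) ->
  (forall f x, X x -> ~ subcell o f (g f) x) ->
  (mu X <= (#|Z|%:R * (1 - (N.+1%:R ^+ d)^-1))%:E)%E.
Proof.
move=> hZ hg.
pose L := [seq (f, h) | f <- enum Z, h <- enum (predC1 (g f))].
have szL : (size L = #|Z| * (N.+1 ^ d - 1))%N.
  rewrite size_allpairs_dep sumnE big_map.
  transitivity (\sum_(f <- enum Z) (N.+1 ^ d - 1))%N.
    by apply: eq_bigr => f _; rewrite -cardE cardC1 card_ffun !card_ord subn1.
  by rewrite big_const_seq count_predT iter_addn_0 -cardE mulnC.
apply: le_trans (mu_le_finite_cover hd (s := L) (F := fun fh => subcell o fh.1 fh.2) _) _.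
  move=> x Xx; have [f fZ hf] := hZ _ Xx; have [h hh] := subcell_cover N hf.
  exists (f, h) => //; apply: allpairs_f_dep; rewrite mem_enum //.
  by apply/negP => /eqP hE; apply: (hg f _ Xx); rewrite -hE.
apply: le_trans (_ : \sum_(fh <- L) ((N.+1%:R ^+ d)^-1)%:E <= _)%E.
  by apply: lee_sum => fh _; exact: mu_subcell.
rewrite sumEFin lee_fin big_const_seq count_predT iter_addr_0 szL.
have N0 : N.+1%:R ^+ d != 0 :> R by rewrite expf_neq0 // pnatr_eq0.
rewrite -[leLHS]mulr_natl natrM natrB ?expn_gt0 // natrX -mulrA ler_wpM2l // mulrBl divff //.
by rewrite mul1r.
Qed.

End FiniteCovers.

(** * Powers of matrices and the Perron eigenvector *)

Lemma norm_complexE (R : rcfType) (z : R[i]) : exists r : R, `|z| = (r%:C)%C.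
Proof. by rewrite normc_def; eexists. Qed.

Lemma uniform_contraction_rate (R : rcfType) (s : seq R[i]) :
  (forall z, z \in s -> `|z| < 1) ->
  exists2 rho : R, 0 < rho < 1 & forall z, z \in s -> `|z| < (rho%:C)%C.
Proof.
elim: s => [_|z s IH h].
  by exists (2^-1) => //; apply/andP; split; lra.
have [|r /andP[r0 r1] hr] := IH; first by move=> u us; apply: h; rewrite in_cons us orbT.
have [t tE] := norm_complexE z.
have t1 : t < 1.
  by have := h z (mem_head _ _); rewrite tE -[1]/(1%:C)%C ltcR.
exists (Num.max r ((t + 1) / 2)).
  by rewrite lt_max r0 gt_max r1 /=; lra.
move=> u; rewrite in_cons => /orP[/eqP ->|/hr us].
  by rewrite tE ltcR lt_max; apply/orP; right; lra.
by apply: lt_le_trans us _; rewrite lecR le_max lexx.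
Qed.

(** By the Cayley-Hamilton theorem the product of the matrices [N - z], over the roots [z] of the
    characteristic polynomial, is zero. If the entries of [N ^ m * ((N - z) * X)] are [O(rho ^ m)] for
    some [rho > |z|], so are those of [N ^ m * X]; so the factors can be removed one at a time. *)
Lemma powers_vanish (R : realType) n (M : 'M[R]_n) :
  (forall z, complex_eigenvalue M z -> `|z| < 1) ->
  forall e : R, 0 < e -> exists m0, forall m, (m0 <= m)%N -> forall i j, `|(M ^+ m) i j| <= e.
Proof.
case: n M => [|n] M hM e e0; first by exists 0%N => m _ [].
pose N : 'M[R[i]]_n.+1 := map_mx (real_complex R) M.
have [s] := closed_field_poly_normal (char_poly N).
rewrite (monicP (char_poly_monic N)) scale1r => sE.
have [z|rho /andP[rho0 rho1] hs] := @uniform_contraction_rate R s.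
  by rewrite -root_prod_XsubC -sE -eigenvalue_root_char; exact: hM.
have rhoC : 0 <= (rho%:C)%C by rewrite -[0]/(0%:C)%C lecR ltW.
pose decays (X : 'M[R[i]]_n.+1) := exists2 C : R[i], 0 <= C &
  forall m i j, `|(N ^+ m * X) i j| <= C * ((rho%:C)%C) ^+ m.
have step z X : `|z| < (rho%:C)%C -> decays ((N - z%:M) * X) -> decays X.
  move=> zr [C C0 hC].
  have zr0 : 0 < (rho%:C)%C - `|z| by rewrite subr_gt0.
  (* [C'] bounds the entries of [X] and satisfies [C <= C' * (rho - |z|)], which makes the induction work. *)
  pose C' := \sum_i \sum_j `|X i j| + C / ((rho%:C)%C - `|z|).
  have Xs i j : `|X i j| <= \sum_i \sum_j `|X i j|.
    rewrite (bigD1 i) //= (bigD1 j) //= -addrA lerDl addr_ge0 // sumr_ge0 // => k _.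
    by rewrite sumr_ge0.
  have s0 : 0 <= \sum_i \sum_j `|X i j| by do 2 (rewrite sumr_ge0 // => ? _).
  have C'0 : 0 <= C' by rewrite addr_ge0 // divr_ge0 // ltW.
  have CC' : C <= C' * ((rho%:C)%C - `|z|).
    by rewrite /C' mulrDl divfK ?gt_eqF // lerDr mulr_ge0 // ltW.
  exists C' => //; elim=> [|m IH] i j.
    rewrite expr0 mul1r expr0 mulr1; apply: le_trans (Xs i j) _.
    by rewrite lerDl divr_ge0 // ltW.
  have -> : N ^+ m.+1 * X = N ^+ m * ((N - z%:M) * X) + z *: (N ^+ m * X).
    have zX : z%:M * X = z *: X := mul_scalar_mx z X.
    by rewrite mulrBl mulrBr zX -scalerAr subrK mulrA -exprSr.
  rewrite mxE; apply: le_trans (ler_normD _ _) _; rewrite [X in _ + `|X|]mxE.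
  apply: le_trans (lerD (hC m i j) (_ : _ <= `|z| * (C' * ((rho%:C)%C) ^+ m))) _.
    by rewrite normrM ler_wpM2l.
  rewrite mulrA -mulrDl exprS mulrA ler_wpM2r ?exprn_ge0 //.
  by rewrite -lerBrDr (le_trans CC') // mulrBr [C' * `|z|]mulrC.
have chain (t : seq R[i]) X : {subset t <= s} ->
    decays ((\prod_(z <- t) (N - z%:M)) * X) -> decays X.
  elim: t X => [|z t IH] X ts; first by rewrite big_nil mul1r.
  rewrite big_cons -mulrA => /(step _ _ (hs _ (ts _ (mem_head _ _)))).
  by apply: IH => u ut; apply: ts; rewrite in_cons ut orbT.
have [|C C0 hC] := chain s 1 (fun z zs => zs).
  have <- : horner_mx N (char_poly N) = \prod_(z <- s) (N - z%:M).
    rewrite sE rmorph_prod; apply: eq_bigr => z _.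
    by rewrite rmorphB /= horner_mx_X horner_mx_C.
  rewrite Cayley_Hamilton mul0r; exists 0 => // m i j.
  by rewrite mulr0 mxE normr0 mul0r.
have [c cE] : exists c : R, C = (c%:C)%C.
  by have [c cE] := norm_complexE C; exists c; rewrite -cE ger0_norm.
have c0 : 0 <= c by rewrite -lecR -cE.
have Mb m i j : `|(M ^+ m) i j| <= c * rho ^+ m.
  rewrite -lecR; have := hC m i j; rewrite mulr1 -(rmorphXn (map_mx (real_complex R))) mxE.
  rewrite cE normc_def /= expr0n /= addr0 sqrtr_sqr => /le_trans; apply.
  by rewrite -(rmorphXn (real_complex R)) -(rmorphM (real_complex R)).
have : geometric c rho @ \oo --> 0 by apply: cvg_geometric; rewrite ger0_norm // ltW.
move=> /cvgrPdist_le /(_ _ e0) [m0 _ hm0]; exists m0 => m mm0 i j.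
apply: le_trans (Mb m i j) _; have := hm0 m mm0.
by rewrite sub0r normrN /= ger0_norm // mulr_ge0 // exprn_ge0 // ltW.
Qed.

Section Expanding.
Variables (R : realType) (d : nat) (A : 'M[R]_d).
Hypothesis hA : expanding A.

Lemma expanding_unitmx : A \in unitmx.
Proof.
rewrite unitmxE unitfE; apply/negP => /det0P[v v0 vA].
have /hA : complex_eigenvalue A 0.
  apply/eigenvalueP; exists (map_mx (real_complex R) v); last by rewrite map_mx_eq0.
  by rewrite -map_mxM vA map_mx0 scale0r.
by rewrite normr0 ltr10.
Qed.

(** The eigenvalues of the inverse of [A] are the inverses of those of [A]. *)
Lemma inverse_powers_vanish (e : R) : 0 < e -> exists m0, forall m, (m0 <= m)%N ->
  forall x : 'cV[R]_d, `|invmx (A ^+ m) *m x| <= e * `|x|.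
Proof.
move=> e0; have Au := expanding_unitmx.
have invX m : invmx (A ^+ m) = (invmx A) ^+ m.
  elim: m => [|m IH]; first by rewrite !expr0 invmx1.
  have Amu : A ^+ m \in unitmx.
    elim: (m) => [|k hk]; first by rewrite expr0 unitmx1.
    by rewrite exprS unitmx_mul Au.
  have Amu1 : A ^+ m.+1 \in unitmx by rewrite exprS unitmx_mul Au.
  rewrite [RHS]exprSr -IH -[RHS](mulKmx Amu1) [in RHS]exprS.
  have -> : A * A ^+ m *m (invmx (A ^+ m) * invmx A) = 1%:M.
    by rewrite -mulmxA mulKVmx // mulmxV.
  by rewrite mulmx1 -?exprS.
have e1 : 0 < e / (d%:R + 1) by rewrite divr_gt0 // ltr_wpDl.
have [|m0 h] := powers_vanish (M := invmx A) _ e1.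
  move=> z /eigenvalueP[v hv v0].
  have e2 : v = z *: (v *m map_mx (real_complex R) A).
    rewrite scalemxAl -hv -mulmxA -map_mxM mulVmx //.
    by rewrite map_mx1 mulmx1.
  have z0 : z != 0 by apply: contra_neq v0 => zE; rewrite e2 zE scale0r.
  have /hA : complex_eigenvalue A z^-1.
    by apply/eigenvalueP; exists v => //; rewrite {2}e2 scalerA mulVf // scale1r.
  by rewrite normfV invf_gt1 // normr_gt0.
exists m0 => m /h hm x; rewrite invX.
apply: norm_le; first by rewrite mulr_ge0 // ltW.
move=> i; rewrite mxE; apply: le_trans (ler_norm_sum _ _ _) _.
apply: le_trans (_ : \sum_(j < d) (e / (d%:R + 1)) * `|x| <= _).
  by apply: ler_sum => j _; rewrite normrM ler_pM // norm_coord.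
rewrite sumr_const card_ord -mulrnAl ler_wpM2r // -mulr_natr mulrAC ler_pdivrMr ?ltr_wpDl //.
by rewrite ler_pM2l // lerDl.
Qed.

End Expanding.

(** Let [v] be an eigenvector for [lam] and [w] its entrywise modulus, so that [lam * w <= S * w]. If
    this were not an equality, multiplying by the positive matrix [S ^ k] would give a positive [z]
    with [lam * z < S * z] in every entry, hence [mu * z <= S * z] for some [mu > lam]. Then
    [(S / mu) ^ m * z >= z] for all [m], whereas the powers of [S / mu] tend to zero by
    [powers_vanish], the spectral radius of [S] being [lam < mu]. *)
Lemma perron_positive_eigenvector (R : realType) n (S : 'M[R]_n) (lam : R) :
  primitive_mx S -> is_perron_eigenvalue S lam ->
  exists2 u : 'cV[R]_n, (forall i, 0 < u i 0) & S *m u = lam *: u.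
Proof.
move=> [S0 [k k0 Sk]] [lam0 Slam _ [_ rad]].
have [v v0 Sv] : exists2 v : 'cV[R]_n, v != 0 & S *m v = lam *: v.
  have : \det (S - lam%:M) == 0.
    move/eigenvalueP: Slam => [v vS v0]; apply/det0P; exists v => //.
    by rewrite mulmxBr vS mul_mx_scalar subrr.
  rewrite -det_tr => /det0P[v v0 hv]; exists v^T.
    by apply: contra_neq v0 => e; rewrite -[v]trmxK e trmx0.
  apply/eqP; rewrite -subr_eq0 -mul_scalar_mx -mulmxBl -[S - _]trmxK -trmx_mul hv.
  by rewrite trmx0.
have [i0 vi0] : exists i, v i 0 != 0.
  apply: contrapT => h; move/eqP: v0; apply; apply/colP => i; rewrite mxE.
  by apply/eqP/negPn/negP => ?; apply: h; exists i.
pose w : 'cV[R]_n := \col_i `|v i 0|.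
have w0 i : 0 <= w i 0 by rewrite mxE.
have Sw i : lam * w i 0 <= (S *m w) i 0.
  have := congr1 (fun x : 'cV[R]_n => `|x i 0|) Sv.
  rewrite !mxE normrM (gtr0_norm lam0) => <-.
  apply: le_trans (ler_norm_sum _ _ _) _; apply: ler_sum => j _.
  by rewrite normrM (ger0_norm (S0 _ _)) mxE.
have Skw i (x : 'cV[R]_n) : (forall i, 0 <= x i 0) -> (exists i, 0 < x i 0) -> 0 < (S ^+ k *m x) i 0.
  move=> x0 [j xj]; rewrite mxE (bigD1 j) //= ltr_pwDl ?mulr_gt0 // sumr_ge0 // => l _.
  by rewrite mulr_ge0 // ltW.
have SwE : S *m w = lam *: w.
  apply/eqP; rewrite -subr_eq0; apply/negPn/negP => ne.
  pose y := S *m w - lam *: w.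
  have y0 i : 0 <= y i 0 by rewrite 3!mxE subr_ge0 [X in X <= _]mxE; have := Sw i; rewrite [(S *m w) _ _]mxE.
  have [j yj] : exists i, 0 < y i 0.
    apply: contrapT => h; move/eqP: ne; apply; apply/colP => i; rewrite [RHS]mxE.
    apply/eqP/negPn/negP => yi; apply: h; exists i.
    by rewrite lt_neqAle eq_sym yi y0.
  pose z := S ^+ k *m w.
  have z0 i : 0 < z i 0.
    by apply: Skw => //; exists i0; rewrite mxE normr_gt0.
  have Sz i : lam * z i 0 < (S *m z) i 0.
    have : 0 < (S ^+ k *m y) i 0 by apply: Skw => //; exists j.
    have SkS : S ^+ k *m S = S *m S ^+ k by rewrite -[LHS]/(S ^+ k * S) -exprSr exprS.
    rewrite mulmxBr -scalemxAr mulmxA SkS -mulmxA -/z.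
    by rewrite [X in 0 < X]mxE [X in _ + X]mxE [X in _ - X]mxE subr_gt0.
  have [mu mu1 Szmu] : exists2 mu, lam < mu & forall i, mu * z i 0 <= (S *m z) i 0.
    exists (\big[Num.min/lam + 1]_i ((S *m z) i 0 / z i 0)).
      apply/bigmin_gtP; split; first by rewrite ltrDl.
      by move=> i _; rewrite ltr_pdivlMr.
    move=> i; rewrite -ler_pdivlMr //; exact: bigmin_le_cond.
  have mu0 : 0 < mu by apply: lt_trans mu1.
  have grow m i : z i 0 <= ((mu^-1 *: S) ^+ m *m z) i 0.
    elim: m i => [|m IH] i; first by rewrite expr0 mul1mx.
    have step : z i 0 <= ((mu^-1 *: S) *m z) i 0.
      by rewrite -scalemxAl [leRHS]mxE ler_pdivlMl.
    apply: le_trans step _; rewrite exprS -mulmxA [leLHS]mxE [leRHS]mxE.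
    by apply: ler_sum => l _; rewrite ler_wpM2l // mxE mulr_ge0 // invr_ge0 ltW.
  have e0 : 0 < z i0 0 / (2 * \sum_i z i 0).
    by rewrite divr_gt0 // mulr_gt0 // (bigD1 i0) //= ltr_pwDl // sumr_ge0 // => i _; rewrite ltW.
  have [|m0 hm0] := powers_vanish (M := mu^-1 *: S) _ e0.
    move=> x /eigenvalueP[v' v'S v'0].
    have muC : (mu%:C)%C != 0 by rewrite gt_eqF // -[0]/(0%:C)%C ltcR.
    have /rad : complex_eigenvalue S ((mu%:C)%C * x).
      apply/eigenvalueP; exists v' => //; rewrite -scalerA -v'S map_mxZ -scalemxAr scalerA /=.
      by rewrite -(rmorphM (real_complex R)) divff ?gt_eqF // scale1r.
    rewrite normrM => h; have : (mu%:C)%C * `|x| < (mu%:C)%C.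
      have -> : (mu%:C)%C = `|(mu%:C)%C| :> R[i].
        by rewrite ger0_norm // -[0]/(0%:C)%C lecR ltW.
      apply: le_lt_trans h _; rewrite ger0_norm; first by rewrite ltcR.
      by rewrite -[0]/(0%:C)%C lecR ltW.
    by rewrite gtr_pMr // -[0]/(0%:C)%C ltcR.
  have := grow m0 i0; apply/negP; rewrite -ltNge mxE.
  apply: le_lt_trans (_ : z i0 0 / 2 < _); last by rewrite ltr_pdivrMr // ltr_pMr // ltr1n.
  apply: le_trans (_ : \sum_j z i0 0 / (2 * \sum_i z i 0) * z j 0 <= _).
    apply: ler_sum => l _; rewrite ler_wpM2r ?(ltW (z0 _)) //.
    exact: le_trans (ler_norm _) (hm0 m0 (leqnn _) _ _).
  rewrite -mulr_sumr invfM mulrA -[leLHS]mulrA mulVf ?mulr1 //.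
  by rewrite gt_eqF // (bigD1 i0) //= ltr_pwDl // sumr_ge0 // => i _; rewrite ltW.
exists w => // i.
have SkE : S ^+ k *m w = lam ^+ k *: w.
  elim: (k) => [|m IH]; first by rewrite !expr0 mul1mx scale1r.
  by rewrite exprS -mulmxA IH -scalemxAr SwE scalerA -exprSr.
have : 0 < (S ^+ k *m w) i 0 by apply: Skw => //; exists i0; rewrite mxE normr_gt0.
by rewrite SkE mxE pmulr_rgt0 // exprn_gt0.
Qed.

(** * Digit multisets as lists *)

Section MultisetCounts.
Variables (R : realType) (d : nat).
Local Notation V := 'cV[R]_d.
Implicit Types (E : {mset V}%mset) (P : pred V).
Local Open Scope mset_scope.

Lemma count_allpairs (T1 T2 T3 : Type) (f : T1 -> T2 -> T3) (P : pred T3) s t :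
  count P [seq f x y | x <- s, y <- t] = (\sum_(x <- s) count (fun y => P (f x y)) t)%N.
Proof.
elim: s => [|x s IH]; first by rewrite big_nil.
by rewrite /= count_cat count_map IH big_cons.
Qed.

Lemma count_mset_add P E1 E2 :
  count P (mset_add E1 E2) = (\sum_(x <- E1) count (fun y => P (x + y)%R) E2)%N.
Proof. by rewrite -count_allpairs; exact: (seq.permP (perm_eq_seq_mset _) P). Qed.

Lemma count_msetD P E1 E2 : count P (E1 `+` E2) = (count P E1 + count P E2)%N.
Proof.
rewrite -count_cat; apply: (seq.permP _ P); apply/allP => x _ /=; apply/eqP.
by rewrite count_cat !count_mem_mset msetE2.
Qed.

Lemma count_msetn1 P (x : V) : count P [mset x] = P x.
Proof. by rewrite enum_msetn /= addn0. Qed.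

Lemma count_big_msetD (I : finType) (Q : pred I) (F : I -> {mset V}) P :
  count P (\big[msetD/mset0]_(i | Q i) F i) = (\sum_(i | Q i) count P (F i))%N.
Proof.
apply: (big_morph (fun E : {mset V} => count P E)) => [E1 E2|].
  exact: count_msetD.
by rewrite enum_mset0.
Qed.

Lemma sum_mset_mulmx (B : 'M[R]_d) E (F : V -> nat) :
  (\sum_(x <- mset_mulmx B E) F x = \sum_(x <- E) F (B *m x)%R)%N.
Proof. by rewrite (perm_big _ (perm_eq_seq_mset _)) big_map. Qed.

Lemma count_ballE E c r : count_ball E c r = count (fun x => (enorm (x - c) <= r)%R) E.
Proof.
rewrite -sum1_count /count_ball sum_mset.
by apply: eq_bigr => x _; rewrite muln1.
Qed.

Lemma ordinaryP E : ordinary E <-> uniq (E : seq V).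
Proof.
split=> [h|h x xE].
  apply/count_mem_uniq => x; rewrite count_mem_mset.
  have [/h -> //|/count_memPn] := boolP (x \in (E : seq V)).
  by rewrite count_mem_mset.
by rewrite -count_mem_mset count_uniq_mem // xE.
Qed.

End MultisetCounts.

Section Digits.
Variables (R : realType) (d n : nat) (A : 'M[R]_d).
Local Notation V := 'cV[R]_d.
Variable D : 'I_n -> 'I_n -> {fset V}.
Implicit Types (i j h : 'I_n) (m p : nat) (P : pred V).

(** The digit multisets of the iterated equation, listed with multiplicity. The recursion splits off
    the summand that is not multiplied by [A]. *)
Fixpoint digits m j i : seq V :=
  if m is m'.+1 then
    flatten [seq [seq x + A *m y | x <- enum_fset (D j h), y <- digits m' h i] | h <- enum 'I_n]
  else if i == j then [:: 0] else [::].

Lemma count_digitsS P m j i : count P (digits m.+1 j i) =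
  (\sum_h \sum_(x <- D j h) count (fun y => P (x + A *m y)%R) (digits m h i))%N.
Proof.
rewrite /= count_flatten -map_comp sumnE big_map big_enum.
by apply: eq_bigr => h _; rewrite /= count_allpairs.
Qed.

(** The sum of digit sets attached to one word of tile types. The exponents start at [c] because
    splitting off the first summand shifts them. *)
Definition word_mset (c m : nat) (F : nat -> {fset V}) : {mset V}%mset :=
  \big[@mset_add R d/[mset 0]%mset]_(k < m) mset_mulmx (A ^+ (c + k)) (mset_of_fset (F k)).

Lemma eq_word_mset c m (F G : nat -> {fset V}) : (forall k, (k < m)%N -> F k = G k) ->
  word_mset c m F = word_mset c m G.
Proof. by move=> FG; apply: eq_bigr => k _; rewrite FG. Qed.

Lemma word_mset_recl c m F : word_mset c m.+1 F =
  mset_add (mset_mulmx (A ^+ c) (mset_of_fset (F 0%N))) (word_mset c.+1 m (F \o S)).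
Proof.
rewrite /word_mset big_ord_recl addn0; congr mset_add.
by apply: eq_bigr => k _; rewrite lift0 addnS addSn.
Qed.

Lemma count_word_shift P c m F :
  count P (word_mset c.+1 m F) = count (fun y => P (A *m y)) (word_mset c m F).
Proof.
elim: m P c F => [|m IH] P c F.
  by rewrite /word_mset !big_ord0 !count_msetn1 mulmx0.
rewrite !word_mset_recl !count_mset_add !sum_mset_mulmx.
apply: eq_bigr => x _; rewrite IH; apply: eq_count => y.
by rewrite exprS mulmxDr mulmxA.
Qed.

Lemma count_wordS P m F : count P (word_mset 0 m.+1 F) =
  (\sum_(x <- F 0%N) count (fun y => P (x + A *m y)%R) (word_mset 0 m (F \o S)))%N.
Proof.
rewrite word_mset_recl count_mset_add sum_mset_mulmx.
rewrite (perm_big _ (perm_eq_seq_mset _)) /=; apply: eq_bigr => x _.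
by rewrite count_word_shift; apply: eq_count => y; rewrite expr0 mul1mx.
Qed.

Lemma count_digit_msetE P m j i : count P (digit_mset A D m j i) =
  (\sum_(J : {ffun 'I_m.+1 -> 'I_n} | (J ord0 == i) && (J ord_max == j))
    count P (word_mset 0 m (fun k : nat => D (J (inord (m - k))) (J (inord (m - k).-1)))))%N.
Proof. by rewrite /digit_mset count_big_msetD. Qed.

Definition extend_word (m : nat) (j : 'I_n) (J : {ffun 'I_m.+1 -> 'I_n}) : {ffun 'I_m.+2 -> 'I_n} :=
  [ffun a : 'I_m.+2 => if (a <= m)%N then J (inord a) else j].

Lemma count_digit_msetS P m j i : count P (digit_mset A D m.+1 j i) =
  (\sum_h \sum_(x <- D j h) count (fun y => P (x + A *m y)%R) (digit_mset A D m h i))%N.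
Proof.
rewrite count_digit_msetE.
rewrite (reindex (@extend_word m j)) /=; last first.
  exists (fun J : {ffun 'I_m.+2 -> 'I_n} => [ffun b : 'I_m.+1 => J (inord b)]).
    move=> J _; apply/ffunP => b; rewrite !ffunE.
    have b2 : (b < m.+2)%N by apply: leq_trans (ltn_ord b) _.
    by rewrite inordK // -[(b <= m)%N]/(b < m.+1)%N ltn_ord inord_val.
  move=> J; rewrite inE => /andP[_ /eqP Jj]; apply/ffunP => a; rewrite !ffunE.
  case: ifP => am; last first.
    rewrite -Jj; congr (J _); apply: val_inj => /=.
    by have := ltn_ord a; move: am; lia.
  by rewrite inordK ?ltnS // inord_val.
have e0 (J : {ffun 'I_m.+1 -> 'I_n}) : (@extend_word m j J) ord0 = J ord0.
  by rewrite ffunE /=; congr (J _); apply: val_inj; rewrite /= inordK.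
have em (J : {ffun 'I_m.+1 -> 'I_n}) : (@extend_word m j J) ord_max = j by rewrite ffunE /= ltnn.
rewrite (eq_bigl (fun J : {ffun 'I_m.+1 -> 'I_n} => J ord0 == i)); last first.
  by move=> J; rewrite e0 em eqxx andbT.
rewrite (partition_big (fun J : {ffun 'I_m.+1 -> 'I_n} => J ord_max) xpredT) //=.
apply: eq_bigr => h _.
transitivity (\sum_(J : {ffun 'I_m.+1 -> 'I_n} | (J ord0 == i) && (J ord_max == h))
  \sum_(x <- D j h) count (fun y => P (x + A *m y)%R)
    (word_mset 0 m (fun k : nat => D (J (inord (m - k))) (J (inord (m - k).-1)))))%N.
  apply: eq_bigr => J /andP[_ /eqP Jh]; rewrite count_wordS.
  have ext (a : nat) : (a <= m)%N -> extend_word j J (inord a) = J (inord a).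
    by move=> am; rewrite ffunE inordK ?am // ltnS ltnW.
  have -> : extend_word j J (inord (m.+1 - 0)) = j.
    by rewrite subn0 -[RHS](em J); congr (extend_word j J _); apply: val_inj; rewrite /= inordK.
  have -> : extend_word j J (inord (m.+1 - 0).-1) = h.
    by rewrite subn0 /= ext // -Jh; congr (J _); apply: val_inj; rewrite /= inordK.
  apply: eq_bigr => x _.
  rewrite (@eq_word_mset _ _ _ (fun k : nat => D (J (inord (m - k))) (J (inord (m - k).-1)))) //.
  move=> k _ /=; rewrite subSS !ext //; last exact: leq_subr.
  exact: leq_trans (leq_pred _) (leq_subr _ _).
rewrite exchange_big /=; apply: eq_bigr => x _.
by rewrite count_digit_msetE.
Qed.

Lemma perm_digits m j i : perm_eq (digit_mset A D m j i) (digits m j i).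
Proof.
apply/seq.permP; elim: m j i => [|m IH] j i P; last first.
  by rewrite count_digit_msetS count_digitsS; apply: eq_bigr => h _; apply: eq_bigr => x _; exact: IH.
rewrite count_digit_msetE /=.
have mE J : word_mset 0 0 J = [mset 0]%mset by rewrite /word_mset big_ord0.
under eq_bigr do rewrite mE count_msetn1.
have oE : (ord_max : 'I_1) = ord0 by apply: val_inj.
case: (eqVneq i j) => [<-|ij].
  rewrite (big_pred1 [ffun=> i]) /= ?addn0 // => J; rewrite oE andbb.
  apply/eqP/eqP => [e|->]; last by rewrite ffunE.
  by apply/ffunP => a; rewrite ffunE (ord1 a) e.
rewrite big1 // => J /andP[/eqP J0 /eqP Jm].
by move: ij; rewrite -J0 -Jm oE eqxx.
Qed.

(** A word of length [p + m] is a word of length [p] followed by a word of length [m]. *)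
Lemma count_digits_add P p m (k : 'I_n) i : count P (digits (p + m) k i) =
  (\sum_j \sum_(x <- digits p k j) count (fun y => P (x + A ^+ p *m y)%R) (digits m j i))%N.
Proof.
elim: p P k => [|p IH] P k.
  rewrite add0n (bigD1 k) //= eqxx big_seq1 big1 ?addn0.
    by apply: eq_count => y; rewrite expr0 mul1mx add0r.
  by move=> j jk; rewrite (negbTE jk) big_nil.
rewrite addSn count_digitsS; under eq_bigr => h _ do under eq_bigr => x _ do rewrite IH.
transitivity (\sum_h \sum_j \sum_(x <- D k h) \sum_(z <- digits p h j)
  count (fun y => P (x + A *m (z + A ^+ p *m y))%R) (digits m j i))%N.
  by apply: eq_bigr => h _; rewrite exchange_big.
rewrite exchange_big /=; apply: eq_bigr => j _.
rewrite big_flatten big_map big_enum /=; apply: eq_bigr => h _.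
rewrite big_allpairs_dep; apply: eq_bigr => x _; apply: eq_bigr => z _.
by apply: eq_count => y; rewrite mulmxDr mulmxA addrA exprS.
Qed.

Lemma size_digits m j i : (size (digits m j i))%:R = (subdivision_mx D ^+ m) j i.
Proof.
elim: m j i => [|m IH] j i.
  by rewrite expr0 mxE /= eq_sym; case: eqP.
rewrite -[size _]count_predT count_digitsS exprS mxE natr_sum.
apply: eq_bigr => h _; under eq_bigr do rewrite count_predT.
by rewrite big_const_seq count_predT iter_addn_0 natrM IH mxE mulrC.
Qed.

Section TileEquation.
Hypothesis Au : A \in unitmx.
Variable T : 'I_n -> set V.
Hypothesis hT : multi_tile_equation A D T.

(** The functional equation iterated [m] times, pulled back to the tiles; invertibility of [A] is
    what makes the implication from right to left true. *)
Lemma tile_digits m i x : T i x <->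
  exists j, exists2 e, e \in digits m j i & T j (A ^+ m *m x - e).
Proof.
elim: m i x => [|m IH] i x.
  rewrite expr0 mul1mx; split=> [hx|[j [e]]].
    by exists i; exists 0; rewrite /= ?eqxx ?inE ?subr0.
  by rewrite /=; case: eqP => // ->; rewrite inE => /eqP ->; rewrite subr0.
split=> [/IH [h [y yh hx]]|[j [e]]].
  have : [set A *m u | u in T h] (A *m (A ^+ m *m x - y)) by exists (A ^+ m *m x - y).
  rewrite hT => -[j _ [t Tt [z /= zD e2]]].
  exists j, (z + A *m y).
    apply/flattenP; exists [seq x + A *m y | x <- enum_fset (D j h), y <- digits m h i].
      by apply/mapP; exists h => //; rewrite mem_enum.
    by apply: allpairs_f.
  have -> : A ^+ m.+1 *m x - (z + A *m y) = t; last by [].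
  move: e2; rewrite mulmxBr mulmxA -[A *m A ^+ m]exprS => /(canRL (addrK _)) ->.
  by rewrite opprD addrA addrAC.
move=> /flattenP[_ /mapP[h _ ->] /allpairsP[[z y] /= [zD yD ->]]] hj.
have : [set A *m u | u in T h] (A *m (A ^+ m *m x - y)).
  rewrite hT; exists j => //; exists (A ^+ m.+1 *m x - (z + A *m y)) => //.
  exists z => //; rewrite mulmxBr mulmxA -[A *m A ^+ m]exprS opprD addrA.
  by rewrite addrAC subrK.
move=> [u Tu /(can_inj (mulKmx Au)) uE].
by apply/IH; exists h; exists y => //; rewrite -uE.
Qed.

End TileEquation.
End Digits.

(** * Porosity of compact sets without interior *)

Section Porosity.
Variables (R : realType) (d : nat).
Local Notation V := 'cV[R]_d.
Implicit Types (X : set V).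

(** Finitely many balls of radius [rho / 4] centred in [X] cover [X], and each of them contains a
    ball disjoint from [X]; the smallest radius of these works everywhere. As the centre [q] is
    arbitrary, the conclusion also holds for all translates of [X]. *)
Lemma compact_porous X : compact X -> (forall x, ~ interior X x) ->
  forall rho : R, 0 < rho -> exists2 eps : R, 0 < eps & forall q : V,
    exists q', forall y, `|y - q'| < eps -> `|y - q| < rho /\ ~ X y.
Proof.
move=> cX nX rho rho0.
have r4 : 0 < rho / 4 by rewrite divr_gt0.
have clX : closed X by apply: compact_closed cX; exact: norm_hausdorff.
have /choice[h hh] (t : V) : exists se : V * R, 0 < se.2 /\
    forall y, `|y - se.1| < se.2 -> `|y - t| < rho / 4 /\ ~ X y.
  have : ~ forall y, `|y - t| < rho / 4 -> X y.
    by move=> H; apply: (nX t); apply/interior_normP; exists (rho / 4).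
  move=> /existsNP[s /not_implyP[st nXs]].
  have : nbhs s (~` X) by apply: open_nbhs_nbhs; split => //; exact: closed_openC.
  move=> /(@interior_normP R d (~` X) s)[e e0 he].
  exists (s, Num.min e (rho / 4 - `|s - t|)); split => /=.
    by rewrite lt_min e0 subr_gt0.
  move=> y; rewrite lt_min => /andP[/he h1 h2]; split => //.
  rewrite -[y](subrK s) -addrA; apply: le_lt_trans (ler_normD _ _) _.
  by rewrite -ltrBrDr.
move: cX; rewrite compact_cover => /(_ V X (fun t => ball t (rho / 4))) [|t Xt|D' hD' cD'].
- by move=> t _; exact: ball_open.
- by exists t => //; exact: ballxx.
pose eps := \big[Num.min/rho / 2]_(t <- D') (h t).2.
exists eps.
  rewrite /eps; elim/big_ind : _ => [|a b a0 b0|t _]; first by rewrite divr_gt0.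
    by rewrite lt_min a0 b0.
  exact: (hh t).1.
have epsr : eps <= rho / 2 by rewrite /eps; elim/big_rec : _ => // t x _ hx; rewrite ge_min hx orbT.
have epst t : t \in D' -> eps <= (h t).2.
  move=> tD; rewrite /eps; have {tD} : t \in enum_fset D' := tD.
  elim: (enum_fset D') => [|a s IH]; first by rewrite in_nil.
  rewrite in_cons big_cons ge_min => /orP[/eqP ->|/IH ->]; by rewrite ?lexx ?orbT.
move=> q; have [[t Xt tq]|nt] := pselect (exists2 t, X t & `|t - q| < rho / 2).
  have [t' /= tD'] := cD' t Xt; rewrite -ball_normE /= => tt'.
  exists (h t').1 => y hy.
  have [h1 h2] := (hh t').2 y (lt_le_trans hy (epst t' tD')); split => //.
  have -> : y - q = (y - t') + (t' - t) + (t - q) by rewrite !addrA !subrK.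
  apply: le_lt_trans (ler_normD _ _) _.
  have := ler_normD (y - t') (t' - t); lra.
exists q => y hy; split; first by lra.
by move=> Xy; apply: nt; exists y => //; lra.
Qed.

(** One translate after the other is avoided inside a smaller and smaller ball, so [eps] depends on
    the number of translates but not on their positions. *)
Lemma finitely_many_porous n (X : 'I_n -> set V) :
  (forall i, compact (X i)) -> (forall i x, ~ interior (X i) x) ->
  forall (N : nat) (rho : R), 0 < rho -> exists2 eps : R, 0 < eps &
    forall s : seq ('I_n * V), (size s <= N)%N -> forall q : V, exists q',
    forall y, `|y - q'| < eps -> `|y - q| < rho /\ forall p, p \in s -> ~ X p.1 (y - p.2).
Proof.
move=> cX nX; elim=> [|N IH] rho rho0.
  by exists rho => // -[] // _ q; exists q => y hy; split.
have /choice[e he] i : exists e : R, 0 < e /\ forall q : V,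
    exists q', forall y, `|y - q'| < e -> `|y - q| < rho /\ ~ X i y.
  by have [e e0 h] := compact_porous (@cX i) (nX i) rho0; exists e.
pose e1 := \big[Num.min/rho]_i e i.
have e10 : 0 < e1 by apply/bigmin_gtP; split => // i _; exact: (he i).1.
have [eps eps0 heps] := IH _ e10.
exists eps => // -[|[i v] s] hs q.
  have [q' h] := heps [::] isT q; exists q' => y /h[h1 _]; split => //.
  by apply: lt_le_trans h1 _; exact: bigmin_le_id.
have [q1 hq1] := (he i).2 (q - v).
have [q' hq'] := heps s hs (q1 + v); exists q' => y /hq'[h1 h2].
have [|h3 h4] := hq1 (y - v).
  rewrite -addrA -opprD [v + _]addrC; apply: lt_le_trans h1 _; exact: bigmin_le_cond.
split; first by move: h3; rewrite opprB addrA subrK.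
by move=> p; rewrite in_cons => /orP[/eqP ->|/h2].
Qed.

End Porosity.

(** * Counting through finite covers *)

Section Covering.
Variables (R : realType) (d : nat).
Local Notation V := 'cV[R]_d.

Lemma cover_by_balls (r eps : R) : 0 < r -> 0 < eps ->
  exists C : seq V, forall x : V, `|x| <= r -> exists2 c, c \in C & `|x - c| <= eps.
Proof.
move=> r0 e0; pose N := Num.truncn (2 * r / eps).
pose h := 2 * r / N.+1%:R.
have hN : h <= eps.
  by rewrite ler_pdivrMr ?ltr0n // -ler_pdivrMl // [X in X <= _]mulrC ltW // truncnS_gt.
have Nh : N.+1%:R * h = 2 * r by rewrite mulrC divfK ?pnatr_eq0.
pose c (f : {ffun 'I_d -> 'I_N.+1}) : V := \col_i (- r + (f i)%:R * h).
exists [seq c f | f <- enum {ffun 'I_d -> 'I_N.+1}] => x xr.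
have /choice[f hf] i : exists s : 'I_N.+1, s%:R * h <= x i 0 + r <= s.+1%:R * h.
  have [|s s1 s2] := @uniform_grid_step _ N (x i 0 + r) h; last by exists s; rewrite s1.
  rewrite Nh; have := le_trans (norm_coord x i) xr.
  by rewrite ler_norml => /andP[? ?]; apply/andP; split; lra.
exists (c (finfun f)); first by apply: map_f; rewrite mem_enum.
apply: norm_le => [|i]; first exact: ltW.
rewrite !mxE ffunE; have /andP[h1] := hf i; rewrite -natr1 mulrDl mul1r => h2.
by rewrite ler_norml; apply/andP; split; lra.
Qed.

Lemma count_le_cover (T I : eqType) (P : pred T) (Q : I -> pred T) (C : seq I) (s : seq T) :
  (forall x, P x -> exists2 c, c \in C & Q c x) ->
  (count P s <= \sum_(c <- C) count (Q c) s)%N.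
Proof.
move=> h; elim: s => [|x s IH] //=.
rewrite big_split /= leq_add //.
case Px: (P x) => //; have [c cC Qc] := h _ Px.
by rewrite (big_rem c) //= Qc.
Qed.

Lemma count_le_cover_bound (T I : eqType) (P : pred T) (Q : I -> pred T) (C : seq I) (s : seq T) M :
  (forall x, P x -> exists2 c, c \in C & Q c x) ->
  (forall c, (count (Q c) s <= M)%N) -> (count P s <= size C * M)%N.
Proof.
move=> h1 h2; apply: leq_trans (count_le_cover _ h1) _.
elim: C {h1} => [|c C IH]; first by rewrite big_nil.
by rewrite big_cons mulSn leq_add.
Qed.

End Covering.

(** * Subdivision of tiles *)

Section Tiles.
Variables (R : realType) (d n : nat).
Hypothesis hd : (1 <= d)%N.
Local Notation V := 'cV[R]_d.
Variables (A : 'M[R]_d) (D : 'I_n -> 'I_n -> {fset V}) (T : 'I_n -> set V).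
Hypothesis hA : expanding A.
Hypothesis hT0 : forall i, T i !=set0.
Hypothesis hTc : forall i, compact (T i).
Hypothesis hT : multi_tile_equation A D T.
Local Notation S := (subdivision_mx D).
Local Notation lam := `|\det A|.
Local Notation mu := (@lebesgue_mu R d).
Local Notation digits := (digits A D).
Variable u : 'cV[R]_n.
Hypothesis u_gt0 : forall i, 0 < u i 0.
Hypothesis Su : S *m u = lam *: u.
Implicit Types (i j k l : 'I_n) (m p : nat) (X Y : set V) (P : pred V).

Let Au : A \in unitmx := expanding_unitmx hA.

Definition norm_bounded X := exists r : R, forall x, X x -> `|x| <= r.
Definition vol X : R := fine (mu X).

Lemma mu_volE X : norm_bounded X -> mu X = (vol X)%:E.
Proof. by move=> [r hr]; rewrite fineK // (mu_bounded_fin hd hr). Qed.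

Lemma vol_ge0 X : 0 <= vol X.
Proof. exact/fine_ge0/mu_ge0. Qed.

Lemma norm_bounded_translate X v : norm_bounded X -> norm_bounded [set x + v | x in X].
Proof.
move=> [r hr]; exists (r + `|v|) => _ [x /hr hx <-].
by apply: le_trans (ler_normD _ _) _; rewrite lerD2r.
Qed.

Lemma vol_translate X v : vol [set x + v | x in X] = vol X.
Proof. by rewrite /vol mu_translate. Qed.

Lemma lam_gt0 : 0 < lam.
Proof. by rewrite normr_gt0 -unitfE -unitmxE. Qed.

Lemma Am_unit m : A ^+ m \in unitmx.
Proof. by elim: m => [|k hk]; rewrite ?expr0 ?unitmx1 // exprS unitmx_mul Au. Qed.

Lemma det_Am m : `|\det (A ^+ m)| = lam ^+ m.
Proof.
elim: m => [|m IH]; first by rewrite expr0 det1 normr1.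
by rewrite exprS (det_mulmx A) normrM IH -exprS.
Qed.

Lemma mu_image_le_lam m X : (mu (mulmx (A ^+ m) @` X) <= (lam ^+ m)%:E * mu X)%E.
Proof. by rewrite -det_Am; exact: (scales_by_det_unit hd (Am_unit m)). Qed.

Lemma mu_image_ge_lam m X : ((lam ^+ m)%:E * mu X <= mu (mulmx (A ^+ m) @` X))%E.
Proof.
have l0 : 0 < lam ^+ m by rewrite exprn_gt0 // lam_gt0.
have := scales_by_det_unit hd (B := invmx (A ^+ m)) _ (mulmx (A ^+ m) @` X).
rewrite unitmx_inv Am_unit => /(_ isT).
rewrite det_inv normfV det_Am => h.
have h2 : (mu X <= (lam ^+ m)^-1%:E * mu (mulmx (A ^+ m) @` X))%E.
  apply: le_trans h; apply: mu_mono => x hx; exists (A ^+ m *m x); first by exists x.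
  by rewrite mulKmx // Am_unit.
apply: le_trans (lee_wpmul2l _ h2) _; first by rewrite lee_fin ltW.
by rewrite muleA -EFinM divff ?gt_eqF // mul1e.
Qed.

Lemma mulmx_norm_bound (B : 'M[R]_d) : exists2 b : R, 0 < b & forall x : V, `|B *m x| <= b * `|x|.
Proof.
exists (1 + \sum_i \sum_j `|B i j|).
  by rewrite ltr_pwDl // sumr_ge0 // => i _; rewrite sumr_ge0.
move=> x; apply: norm_le => [|i].
  by rewrite mulr_ge0 // addr_ge0 // sumr_ge0 // => i _; rewrite sumr_ge0.
rewrite mxE; apply: le_trans (ler_norm_sum _ _ _) _.
apply: le_trans (_ : \sum_j `|B i j| * `|x| <= _).
  by apply: ler_sum => j _; rewrite normrM ler_wpM2l // norm_coord.
rewrite -mulr_suml ler_wpM2r // [in leRHS](bigD1 i) //= addrCA lerDl addr_ge0 // sumr_ge0 // => j _.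
by rewrite sumr_ge0.
Qed.

Lemma norm_bounded_image (B : 'M[R]_d) X : norm_bounded X -> norm_bounded (mulmx B @` X).
Proof.
move=> [r hr]; have [b b0 hb] := mulmx_norm_bound B.
exists (b * r) => _ [x /hr hx <-]; apply: le_trans (hb x) _.
by rewrite ler_wpM2l // ltW.
Qed.

Lemma vol_image m X : norm_bounded X -> vol (mulmx (A ^+ m) @` X) = lam ^+ m * vol X.
Proof.
move=> bX; have bI := norm_bounded_image (A ^+ m) bX.
apply/eqP; rewrite eq_le -!lee_fin EFinM -!mu_volE //.
by rewrite mu_image_le_lam mu_image_ge_lam.
Qed.

Lemma tiles_bounded : exists2 r : R, 0 < r & forall i x, T i x -> `|x| <= r.
Proof.
have /choice[r hr] i : exists r, 0 < r /\ forall x, T i x -> `|x| <= r.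
  by have [r r0 hr] := compact_norm_bounded (@hTc i); exists r.
exists (1 + \sum_i r i).
  by rewrite ltr_pwDl // sumr_ge0 // => i _; rewrite ltW // (hr i).1.
move=> i x /(hr i).2 /le_trans; apply; rewrite (bigD1 i) //= addrCA lerDl addr_ge0 //.
by rewrite sumr_ge0 // => j _; rewrite ltW // (hr j).1.
Qed.

Lemma tile_bounded i : norm_bounded (T i).
Proof. by have [r _ hr] := tiles_bounded; exists r; exact: hr. Qed.

(** Pairing with the Perron eigenvector cancels the subdivision matrix. *)
Lemma eigenvector_pairing m (b : 'I_n -> R) :
  \sum_i u i 0 * \sum_j (S ^+ m) j i * b j = lam ^+ m * \sum_i u i 0 * b i.
Proof.
have Smu : S ^+ m *m u = lam ^+ m *: u.
  elim: m => [|m IH]; first by rewrite !expr0 mul1mx scale1r.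
  by rewrite exprS -mulmxA IH -scalemxAr Su scalerA -exprSr.
rewrite mulr_sumr.
under eq_bigr do rewrite mulr_sumr.
rewrite exchange_big /=; apply: eq_bigr => j _.
rewrite mulrA -[lam ^+ m * _](_ : (lam ^+ m *: u) j 0 = _); last by rewrite mxE.
rewrite -Smu mxE mulr_suml; apply: eq_bigr => i _; ring.
Qed.

Section Deficit.
Variables (X : 'I_n -> set V) (m : nat).
Hypothesis bX : forall i, norm_bounded (X i).

(** Subadditivity for the subdivision of the inflated set [X l], where the translates of [X k] selected
    by [P] are replaced by the set [Y]. *)
Lemma vol_subdivision_le k l P Y : norm_bounded Y ->
  (forall x, X l x -> Y (A ^+ m *m x) \/
     exists j e, [/\ e \in digits m j l, X j (A ^+ m *m x - e) & ~~ ((j == k) && P e)]) ->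
  lam ^+ m * vol (X l) <=
    \sum_j (S ^+ m) j l * vol (X j) - (count P (digits m k l))%:R * vol (X k) + vol Y.
Proof.
move=> bY h; rewrite -vol_image //.
pose Q j e := ~~ ((j == k) && P e).
pose L := [seq (j, e) | j <- enum 'I_n, e <- [seq e <- digits m j l | Q j e]].
pose W (q : 'I_n * V) := [set x + q.2 | x in X q.1].
pose Z := [set y : V | exists2 q, q \in L & W q y].
have LE (F : 'I_n -> R) : \sum_(q <- L) F q.1 = \sum_j (S ^+ m) j l * F j - (count P (digits m k l))%:R * F k.
  rewrite big_allpairs_dep /= big_enum /=.
  transitivity (\sum_j (count (Q j) (digits m j l))%:R * F j).
    apply: eq_bigr => j _; rewrite big_const_seq count_predT size_filter iter_addr_0.
    by rewrite mulr_natl.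
  rewrite (bigD1 k) //= [in RHS](bigD1 k) //= addrAC -mulrBl; congr (_ + _).
    congr (_ * _); rewrite -(size_digits A) -(count_predC P (digits m k l)) natrD addrAC subrr add0r.
    by congr (_%:R); apply: eq_count => e; rewrite /Q eqxx.
  apply: eq_bigr => j jk; rewrite -(size_digits A) -count_predT; congr (_%:R * _).
  by apply: eq_count => e; rewrite /Q (negbTE jk).
have Wb q : norm_bounded (W q) by apply: norm_bounded_translate.
rewrite -LE -lee_fin EFinD -mu_volE; last exact: norm_bounded_image.
rewrite -sumEFin addeC -mu_volE //.
apply: le_trans (mu_mono (Y := Y `|` Z) _) _.
  move=> _ [x Xx <-]; have [Yx|[j [e [eD hx q]]]] := h _ Xx; [by left|right].
  exists (j, e); last by exists (A ^+ m *m x - e) => //; rewrite subrK.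
  by apply: allpairs_f_dep; rewrite ?mem_enum // mem_filter eD andbT.
apply: le_trans (mu_setU hd _ _) _; apply: leeD => //.
apply: le_trans (mu_le_finite_cover hd (s := L) (F := W) _) _ => //.
by apply: lee_sum => q _; rewrite mu_volE // vol_translate.
Qed.

Hypothesis hX : forall i x, X i x -> exists j, exists2 e, e \in digits m j i & X j (A ^+ m *m x - e).

(** The key estimate. The subdivision inequalities of all the [X i], weighted by the entries of the
    eigenvector, add up to an equality by [eigenvector_pairing]. So there is no slack, and replacing
    the selected translates of [X k] by [Y] cannot decrease the total volume of the pieces. *)
Lemma count_vol_le k l P Y : norm_bounded Y ->
  (forall x, X l x -> Y (A ^+ m *m x) \/
     exists j e, [/\ e \in digits m j l, X j (A ^+ m *m x - e) & ~~ ((j == k) && P e)]) ->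
  (count P (digits m k l))%:R * vol (X k) <= vol Y.
Proof.
move=> bY h.
have h1 i : lam ^+ m * vol (X i) <= \sum_j (S ^+ m) j i * vol (X j).
  have b0 : norm_bounded set0 by exists 0.
  have := @vol_subdivision_le i i pred0 set0 b0 _.
  rewrite count_pred0 mul0r subr0 {3}/vol mu0 // addr0; apply => x /hX[j [e eD hx]].
  by right; exists j, e; rewrite andbF.
have h2 := vol_subdivision_le bY h.
have := eigenvector_pairing m (fun j => vol (X j)).
rewrite [RHS]mulr_sumr (bigD1 l) //= [in RHS](bigD1 l) //=.
have h3 : \sum_(i | i != l) lam ^+ m * (u i 0 * vol (X i)) <=
   \sum_(i | i != l) u i 0 * \sum_j (S ^+ m) j i * vol (X j).
  by apply: ler_sum => i _; rewrite mulrCA ler_wpM2l // ltW.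
have := ler_wpM2l (ltW (u_gt0 l)) h2.
rewrite mulrDr mulrBr => h4 h5.
rewrite -(ler_pM2l (u_gt0 l)); lra.
Qed.

End Deficit.

Lemma tile_subdivision m i x : T i x ->
  exists j, exists2 e, e \in digits m j i & T j (A ^+ m *m x - e).
Proof. by move=> /(tile_digits Au hT m). Qed.

Lemma size_vol_le m k l : (size (digits m k l))%:R * vol (T k) <= lam ^+ m * vol (T l).
Proof.
rewrite -(vol_image m (@tile_bounded l)) -count_predT.
apply: (count_vol_le tile_bounded (@tile_subdivision m)).
  exact/norm_bounded_image/tile_bounded.
by move=> x hx; left; exists x.
Qed.

(** * Packing of tiles of positive volume *)

Variable p0 : nat.
Hypothesis p0_pos : forall i j, 0 < (S ^+ p0) i j.

Lemma digits_nonempty i j : exists e, e \in digits p0 i j.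
Proof.
have := p0_pos i j; rewrite -(size_digits A) ltr0n.
by case: (digits p0 i j) => // e s _; exists e; rewrite mem_head.
Qed.

Lemma mem_digits_add p m k j i x y : x \in digits p k j -> y \in digits m j i ->
  x + A ^+ p *m y \in digits (p + m) k i.
Proof.
move=> xD yD; rewrite -has_pred1 has_count count_digits_add (bigD1 j) //=.
rewrite (big_rem x) //= -addnA ltn_addr // -has_count; apply/hasP.
by exists y => /=.
Qed.

(** By primitivity the inflation of any tile contains a translate of [T j]. *)
Lemma vol_tiles_gt0 j : 0 < vol (T j) -> forall i, 0 < vol (T i).
Proof.
move=> h i; have := size_vol_le p0 j i; rewrite size_digits => h2.
have : 0 < lam ^+ p0 * vol (T i) by apply: lt_le_trans h2; rewrite mulr_gt0.
by rewrite pmulr_rgt0 // exprn_gt0 // lam_gt0.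
Qed.

Section Packing.
Hypothesis T_gt0 : forall i, 0 < vol (T i).

(** [count_vol_le] for the tiles themselves: [Y] only has to contain the selected translates. *)
Lemma tile_count_vol_le m k l P Y : norm_bounded Y ->
  (forall t e, T k t -> e \in digits m k l -> P e -> Y (t + e)) ->
  (count P (digits m k l))%:R * vol (T k) <= vol Y.
Proof.
move=> bY h; apply: (count_vol_le tile_bounded (@tile_subdivision m)) => // x.
move=> /(tile_subdivision m)[j [e eD hx]].
case: (boolP ((j == k) && P e)) => [/andP[/eqP jk Pe]|q]; last first.
  by right; exists j, e; split.
by left; rewrite -[A ^+ m *m x](subrK e); apply: h; rewrite -?jk.
Qed.

(** A repeated digit would count the same translate of the tile twice. *)
Lemma uniq_digits m k l : uniq (digits m k l).
Proof.
apply/count_mem_uniq => x.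
have : (count_mem x (digits m k l))%:R * vol (T k) <= vol [set t + x | t in T k].
  apply: tile_count_vol_le; first exact/norm_bounded_translate/tile_bounded.
  by move=> t e Tt _ /eqP ->; exists t.
rewrite vol_translate -[leRHS]mul1r ler_pM2r // (ler_nat _ _ 1).
have [xD|/count_memPn -> //] := boolP (x \in digits m k l).
have : (0 < count_mem x (digits m k l))%N by rewrite -has_count has_pred1.
by lia.
Qed.

(** The translates by digits that lie in a ball are contained in a slightly larger ball, whose volume
    does not depend on its centre. *)
Lemma packing_bound (r : R) : exists M, forall m k l (c : V),
  (count (fun e : V => (`|e - c| <= r)%R) (digits m k l) <= M)%N.
Proof.
have [r0 r00 hr0] := tiles_bounded.
pose Y0 : set V := [set y | `|y| <= r + r0].
have bY0 : norm_bounded Y0 by exists (r + r0).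
exists (\sum_k Num.truncn (vol Y0 / vol (T k)))%N => m k l c.
have : (count (fun e : V => (`|e - c| <= r)%R) (digits m k l))%:R * vol (T k) <= vol [set y + c | y in Y0].
  apply: tile_count_vol_le; first exact: norm_bounded_translate.
  move=> t e /hr0 ht _ hc; exists (t + e - c); last by rewrite subrK.
  by rewrite /Y0 /= -addrA addrC; apply: le_trans (ler_normD _ _) _; rewrite lerD.
rewrite vol_translate => h; rewrite (bigD1 k) //=; apply: leq_trans (leq_addr _ _).
by rewrite truncn_ge_nat ?divr_ge0 ?vol_ge0 // ler_pdivlMr.
Qed.

(** If two digits were very close, two translates of [T k] would fit into a thin neighbourhood of one
    of them, of volume less than [2 * vol (T k)]. *)
Lemma digits_separated : exists2 eps : R, 0 < eps & forall m k l x y,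
  x \in digits m k l -> y \in digits m k l -> x != y -> eps <= `|x - y|.
Proof.
have /choice[eta heta] k : exists eta : R, 0 < eta /\ (mu (thicken (T k) eta) < (2 * vol (T k))%:E)%E.
  have h : (mu (T k) < (2 * vol (T k))%:E)%E.
    by rewrite (mu_volE (@tile_bounded k)) lte_fin ltr_pMl // ltr1n.
  by have [eta e0 he] := mu_thicken hd (@hTc k) h; exists eta.
exists (\big[Num.min/1]_k eta k).
  by apply/bigmin_gtP; split => // k _; exact: (heta k).1.
move=> m k l x y xD yD xy; rewrite leNgt; apply/negP => lt.
have lt2 : `|x - y| < eta k by apply: lt_le_trans lt _; exact: bigmin_le_cond.
have bY : norm_bounded (thicken (T k) (eta k)).
  have [r hr] := @tile_bounded k; exists (r + eta k) => z [t /hr ht hz].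
  by rewrite -[z](subrK t) addrC; apply: le_trans (ler_normD _ _) _; rewrite lerD.
have : (count (pred2 x y) (digits m k l))%:R * vol (T k) <= vol [set z + x | z in thicken (T k) (eta k)].
  apply: tile_count_vol_le; first exact: norm_bounded_translate.
  move=> t e Tt _ /orP[/eqP ->|/eqP ->].
    by exists t => //; exists t => //; rewrite subrr normr0 ltW // (heta k).1.
  exists (t + (y - x)); last by rewrite -addrA subrK.
  by exists t => //; rewrite addrAC subrr add0r distrC ltW.
rewrite vol_translate => h.
have c2 : (2 <= count (pred2 x y) (digits m k l))%N.
  have xyu : uniq [:: x; y] by rewrite /= inE xy.
  rewrite -size_filter; apply: (uniq_leq_size xyu) => z.
  by rewrite !inE mem_filter /= => /orP[] /eqP ->; rewrite ?xD ?yD eqxx ?orbT.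
have := (heta k).2; rewrite mu_volE // lte_fin ltNge => /negP; apply.
by apply: le_trans h; rewrite ler_wpM2r ?vol_ge0 // ler_nat.
Qed.

End Packing.

(** * Positive volume from weak discreteness *)

Definition ball_bound m k l M := forall c : V,
  (count (fun e : V => (enorm (e - c) <= 1)%R) (digits m k l) <= M)%N.

(** Words from [j] to [i] extend on both sides, by [p0] letters, to words with the end letters [k] and
    [l]. So the digit multisets for [k] and [l] contain images of all the others under an affine map
    with the fixed linear part [A ^+ p0], and balls are covered by finitely many unit balls. *)
Lemma weak_bound_transfer k l M : (forall m, (1 <= m)%N -> ball_bound m k l M) ->
  forall r, 0 < r -> exists M', forall m, (1 <= m)%N -> forall i j (c : V),
    (count (fun e : V => (`|e - c| <= r)%R) (digits m i j) <= M')%N.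
Proof.
move=> hM r r0; have [b b0 hb] := mulmx_norm_bound (A ^+ p0).
have d0 : 0 < d%:R :> R by rewrite ltr0n.
have id0 : 0 < d%:R^-1 :> R by rewrite invr_gt0.
have [C hC] := @cover_by_balls R d (b * r) d%:R^-1 (mulr_gt0 b0 r0) id0.
exists (size C * M)%N => m m1 i j c.
have [x0 x0D] := digits_nonempty k i; have [y0 y0D] := digits_nonempty j l.
pose Ap := A ^+ p0; pose Am := A ^+ m.
pose c' := x0 + Ap *m (c + Am *m y0).
pose P' (e' : V) := (`|e' - c'| <= b * r)%R.
have le1 : (count (fun e : V => (`|e - c| <= r)%R) (digits m i j) <= count P' (digits (p0 + (m + p0)) k l))%N.
  rewrite count_digits_add (bigD1 i) //= (big_rem x0) //= -addnA.
  apply: leq_trans (leq_addr _ _).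
  rewrite count_digits_add (bigD1 j) //=; apply: leq_trans (leq_addr _ _).
  rewrite -sum1_count big_mkcond /=; apply: leq_sum => z _.
  case: ifP => // zc; rewrite -has_count; apply/hasP; exists y0 => //=.
  rewrite /P' /c' opprD addrACA subrr add0r -mulmxBr opprD addrACA subrr addr0.
  by apply: le_trans (hb _) _; rewrite ler_pM2l.
apply: leq_trans le1 _.
apply: (count_le_cover_bound (C := C) (Q := fun c1 e' => (enorm (e' - (c' + c1)) <= 1)%R)).
  move=> e' /hC[c1 c1C hc1]; exists c1 => //.
  apply: le_trans (enorm_le_norm _) _; rewrite opprD addrA.
  by rewrite mulrC -ler_pdivlMr // mul1r.
by move=> c1; apply: hM; rewrite addnCA ltn_addr.
Qed.

Lemma floor_cell (r : R) (x : V) (K : nat) : `|x| <= r -> 2 * r < K%:R ->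
  exists f : {ffun 'I_d -> 'I_K}, cell (const_mx (- r)) f x.
Proof.
move=> xr rK.
have /choice[f hf] (i : 'I_d) : exists s : 'I_K, s%:R <= x i 0 + r <= s%:R + 1.
  have := le_trans (norm_coord x i) xr; rewrite ler_norml => /andP[h1 h2].
  have x0 : 0 <= x i 0 + r by lra.
  have /andP[t1 t2] := truncn_itv x0.
  have tK : (Num.truncn (x i 0 + r)%R < K)%N.
    by rewrite truncn_lt_nat //; lra.
  by exists (Ordinal tK); rewrite /= t1 natr1 ltW.
exists (finfun f) => i; rewrite !mxE ffunE.
by have /andP[? ?] := hf i; apply/andP; split; lra.
Qed.

Lemma cell_dist K (o : V) (f : {ffun 'I_d -> 'I_K}) x y : cell o f x -> cell o f y -> `|x - y| <= 1.
Proof.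
move=> hx hy; apply: norm_le => // i; have := hx i; have := hy i; rewrite !mxE.
by move=> /andP[? ?] /andP[? ?]; rewrite ler_norml; apply/andP; split; lra.
Qed.

(** A cell that meets the inflated tile is contained in the image of a thin neighbourhood of [T l],
    because [A ^- m] shrinks it to a small set. So the number of these cells is bounded by the volume
    of that image, which [mu_thicken] keeps below [lam ^+ m * delta]. *)
Lemma tile_cells l (delta : R) : (mu (T l) < delta%:E)%E ->
  exists m0, forall m, (m0 <= m)%N -> exists K (o : V) (Z : {set {ffun 'I_d -> 'I_K}}),
  [/\ forall x, T l x -> exists2 f, f \in Z & cell o f (A ^+ m *m x)
    & #|Z|%:R <= lam ^+ m * delta].
Proof.
move=> hdelta; have [eta eta0 heta] := mu_thicken hd (@hTc l) hdelta.
have [m0 hm0] := inverse_powers_vanish hA eta0.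
exists m0 => m mm0.
have [r hr] := norm_bounded_image (A ^+ m) (@tile_bounded l).
pose K := (Num.truncn (2 * r)).+1.
have rK : 2 * r < K%:R by exact: truncnS_gt.
pose Z : {set {ffun 'I_d -> 'I_K}} :=
  [set f | `[< exists2 x, T l x & cell (const_mx (- r)) f (A ^+ m *m x) >]]%SET.
exists K, (const_mx (- r)), Z; split=> [x Tx|].
  have xr : `|A ^+ m *m x| <= r by apply: hr; exists x.
  have [f hf] := floor_cell xr rK.
  by exists f => //; rewrite inE; apply/asboolP; exists x.
rewrite -lee_fin.
apply: le_trans (card_cells_le (o := const_mx (- r)) (X := mulmx (A ^+ m) @` thicken (T l) eta) _) _.
  move=> f; rewrite inE => /asboolP[x Tx hx] y hy.
  exists (invmx (A ^+ m) *m y); last by rewrite mulKVmx // Am_unit.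
  exists x => //; rewrite -[x in _ - x](mulKmx (Am_unit m)) -mulmxBr.
  apply: le_trans (hm0 m mm0 _) _; rewrite -[leRHS]mulr1 ler_wpM2l ?(ltW eta0) //.
  exact: cell_dist hy hx.
apply: le_trans (mu_image_le_lam _ _) _; rewrite EFinM.
by apply: lee_wpmul2l; [rewrite lee_fin exprn_ge0|exact: ltW].
Qed.

Hypothesis hn : (1 <= n)%N.

(** The number of digits of level [m] is of the order of [lam ^+ m]. Each digit [e] is attached to a
    cell that meets an inflated tile, and at most [M] of them to the same cell, while null tiles
    would meet at most [lam ^+ m * delta] cells with [delta] arbitrarily small. *)
Lemma vol_gt0_of_weak_bound M :
  (forall m, (1 <= m)%N -> forall i j (c : V),
    (count (fun e : V => (`|e - c| <= 1)%R) (digits m i j) <= M)%N) ->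
  exists j, 0 < vol (T j).
Proof.
move=> hM; apply: contrapT => h0.
have v0 j : vol (T j) = 0.
  apply/eqP; rewrite eq_le vol_ge0 andbT leNgt; apply/negP => hj.
  by apply: h0; exists j.
(* Small enough that [n * M * delta < 1]: summing over the [n] types [j] is then contradictory. *)
pose delta : R := ((n * M)%:R + 1)^-1.
have delta0 : 0 < delta by rewrite invr_gt0 ltr_wpDl.
have /choice[m0 hm0] l : exists m0, forall m, (m0 <= m)%N -> exists K (o : V) (Z : {set {ffun 'I_d -> 'I_K}}),
  [/\ forall x, T l x -> exists2 f, f \in Z & cell o f (A ^+ m *m x)
    & #|Z|%:R <= lam ^+ m * delta].
  by apply: tile_cells; rewrite (mu_volE (@tile_bounded l)) v0 lte_fin.
pose m := (\max_l m0 l).+1.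
have sz j i : (size (digits m j i))%:R <= lam ^+ m * delta * M%:R.
  have [|K [c0 [Z [hZ cZ]]]] := hm0 i m.
    by rewrite leqW // leq_bigmax.
  have [t Tt] := @hT0 j.
  apply: le_trans (_ : (#|Z| * M)%:R <= _); last by rewrite natrM ler_wpM2r.
  rewrite ler_nat cardE.
  have <- : count (fun e : V => e \in digits m j i) (digits m j i) = size (digits m j i).
    by apply/eqP; rewrite -all_count; apply/allP.
  apply: (count_le_cover_bound (Q := fun f e => (`|e - (cell_corner c0 f - t)| <= 1)%R)).
    move=> e eD; pose x := invmx (A ^+ m) *m (t + e).
    have xE : A ^+ m *m x = t + e by rewrite mulKVmx // Am_unit.
    have /hZ[f fZ hf] : T i x.
      by apply/(tile_digits Au hT m); exists j, e => //; rewrite xE addrK.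
    exists f; first by rewrite mem_enum.
    rewrite opprB addrA [e + t]addrC -xE; apply: cell_dist hf _.
    by move=> a; rewrite !mxE lexx lerDl ler01.
  by move=> f; apply: hM.
have := eigenvector_pairing m (fun _ => 1).
apply/eqP; rewrite lt_eqF //.
have U0 : 0 < \sum_i u i 0 * 1.
  by rewrite (bigD1 (Ordinal hn)) //= mulr1 ltr_pwDl // sumr_ge0 // => i _; rewrite mulr1 ltW.
apply: le_lt_trans (_ : \sum_i u i 0 * 1 * (lam ^+ m * delta * (n * M)%:R) < _).
  apply: ler_sum => i _; rewrite mulr1 ler_wpM2l ?(ltW (u_gt0 i)) //.
  apply: le_trans (_ : \sum_(j < n) lam ^+ m * delta * M%:R <= _).
    by apply: ler_sum => j _; rewrite mulr1 -(size_digits A).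
  by rewrite sumr_const card_ord natrM -[leLHS]mulr_natl mulrCA.
rewrite -mulr_suml mulrC ltr_pM2r // -mulrA -[ltRHS]mulr1 ltr_pM2l ?exprn_gt0 ?lam_gt0 //.
by rewrite mulrC ltr_pdivrMr ?mul1r ?ltrDl // ltr_wpDl.
Qed.

(** * Interior and boundary of tiles *)

Lemma tile_closed i : closed (T i).
Proof. by apply: compact_closed (@hTc i); exact: norm_hausdorff. Qed.

(** The pieces of level [m] of a tile have diameters tending to zero, and, by primitivity, [p0] further
    levels yield a piece of the prescribed type [j]. *)
Lemma small_tile_piece i j x (rho : R) : T i x -> 0 < rho ->
  exists m e, e \in digits m j i /\
    forall t, T j t -> exists2 z, A ^+ m *m z = t + e & `|z - x| < rho.
Proof.
move=> Tx rho0; have [r0 r00 hr0] := tiles_bounded.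
have eta0 : 0 < rho / (3 * r0) by rewrite divr_gt0 // mulr_gt0.
have [m hm] := inverse_powers_vanish hA eta0.
have [j' [e' e'D Tj']] := tile_subdivision m Tx.
have [d0 d0D] := digits_nonempty j j'.
exists (p0 + m)%N, (d0 + A ^+ p0 *m e'); split; first exact: mem_digits_add d0D e'D.
move=> t Tt; pose s := invmx (A ^+ p0) *m (t + d0).
have sE : A ^+ p0 *m s = t + d0 by rewrite mulKVmx // Am_unit.
have Ts : T j' s.
  by apply/(tile_digits Au hT p0); exists j, d0 => //; rewrite sE addrK.
exists (invmx (A ^+ m) *m (s + e')).
  have -> : A ^+ (p0 + m) = A ^+ p0 *m A ^+ m by rewrite exprD.
  by rewrite -mulmxA mulKVmx ?Am_unit // mulmxDr sE addrA.
rewrite -[x in _ - x](mulKmx (Am_unit m)) -mulmxBr.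
apply: le_lt_trans (hm m (leqnn _) _) _.
have h1 : `|s + e' - A ^+ m *m x| <= 2 * r0.
  have -> : s + e' - A ^+ m *m x = s - (A ^+ m *m x - e') by rewrite opprB addrA.
  apply: le_trans (ler_normB _ _) _.
  by have := hr0 _ _ Ts; have := hr0 _ _ Tj'; lra.
apply: le_lt_trans (ler_wpM2l (ltW eta0) h1) _.
rewrite mulrAC ltr_pdivrMr ?mulr_gt0 // ltr_pM2l // ltr_pM2r //.
by rewrite ltr_nat.
Qed.

Lemma interior_piece m i j e x : e \in digits m j i ->
  interior (T j) (A ^+ m *m x - e) -> interior (T i) x.
Proof.
move=> eD /interior_normP[r r0 hr]; apply/interior_normP.
have [b b0 hb] := mulmx_norm_bound (A ^+ m).
exists (r / b); first by rewrite divr_gt0.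
move=> y hy; apply/(tile_digits Au hT m); exists j, e => //; apply: hr.
rewrite opprB addrA subrK -mulmxBr; apply: le_lt_trans (hb _) _.
by rewrite mulrC -ltr_pdivlMr.
Qed.

(** If one tile has an interior point, so has every small piece of its type, and there are such
    pieces near every point of every tile. *)
Lemma tile_closure_interior j0 : interior (T j0) !=set0 ->
  forall i, T i = closure (interior (T i)).
Proof.
move=> [w hw] i; apply/seteqP; split; last first.
  move=> x /(closure_subset (@interior_subset _ (T i))).
  by rewrite -(closure_id _).1 //; exact: tile_closed.
move=> x Tx B /nbhs_ballP[rho /= rho0 hB].
have [m [e [eD h]]] := small_tile_piece j0 Tx rho0.
have [z zE zx] := h w (interior_subset hw).
exists z; split; last by apply: hB; rewrite -ball_normE /= distrC.
by apply: (interior_piece eD); rewrite zE addrK.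
Qed.

(** An inflation of a tile with interior contains a unit cell. *)
Lemma vol_gt0_of_interior j : interior (T j) !=set0 -> 0 < vol (T j).
Proof.
move=> [x /interior_normP[r r0 hr]].
have r2 : 0 < r / 2 by rewrite divr_gt0.
have [m hm] := inverse_powers_vanish hA r2.
pose f0 : {ffun 'I_d -> 'I_1} := [ffun=> ord0].
have := @card_cells_le R d 1 (A ^+ m *m x) [set f0]%SET (mulmx (A ^+ m) @` T j).
rewrite cards1 => /(_ _)h.
have {h} : (1%:E <= mu (mulmx (A ^+ m) @` T j))%E.
  apply: h => f _ y hy; exists (invmx (A ^+ m) *m y); last by rewrite mulKVmx ?Am_unit.
  apply: hr; rewrite -[x in _ - x](mulKmx (Am_unit m)) -mulmxBr.
  apply: le_lt_trans (hm m (leqnn _) _) _.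
  apply: le_lt_trans (_ : r / 2 * 1 < _); last by lra.
  rewrite ler_wpM2l ?(ltW r2) //; apply: (cell_dist hy) => i.
  by rewrite !mxE (ord1 (f i)) addr0 lexx lerDl ler01.
move=> /le_trans/(_ (mu_image_le_lam m (T j))).
rewrite (mu_volE (@tile_bounded j)) -EFinM lee_fin => h.
have : 0 < lam ^+ m * vol (T j) by apply: lt_le_trans h.
by rewrite pmulr_rgt0 // exprn_gt0 // lam_gt0.
Qed.

(** The boundary of an inflated tile is covered by the boundaries of its pieces, and a piece inside
    the interior of the tile can be left out. By [count_vol_le] with [Y] empty, the boundary of
    this piece is null. *)
Lemma vol_boundary_eq0 : (forall j, T j = closure (interior (T j))) ->
  forall k, mu (boundary (T k)) = 0%E.
Proof.
move=> hcl k.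
have bE i : boundary (T i) = T i `\` interior (T i).
  by rewrite /boundary -(closure_id _).1 //; exact: tile_closed.
have bB i : norm_bounded (boundary (T i)).
  by have [r hr] := @tile_bounded i; exists r => x; rewrite bE => -[/hr].
have [x hx] : interior (T k) !=set0.
  apply/set0P/negP => /eqP h0; have [t] := @hT0 k.
  by rewrite hcl h0 closure0.
have /interior_normP[rho rho0 hrho] := hx.
have [m [e [eD h]]] := small_tile_piece k (interior_subset hx) rho0.
have sub i y : boundary (T i) y ->
    exists j, exists2 e, e \in digits m j i & boundary (T j) (A ^+ m *m y - e).
  rewrite bE => -[Ty nTy]; have [j [e1 e1D Tj]] := tile_subdivision m Ty.
  by exists j, e1 => //; rewrite bE; split => // hj; apply: nTy; exact: interior_piece e1D hj.
have bs0 : norm_bounded set0 by exists 0.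
have : (count (pred1 e) (digits m k k))%:R * vol (boundary (T k)) <= vol set0.
  apply: (count_vol_le bB sub) => // y hy; right; have [j [e1 e1D hj]] := sub _ _ hy.
  exists j, e1; split => //; apply/negP => /andP[/eqP jk /eqP e1E].
  move: hj hy; rewrite !bE jk e1E => -[/h[z zE zx] _] [_]; apply.
  have -> : y = z.
    by apply: (can_inj (mulKmx (Am_unit m))); rewrite zE subrK.
  apply/interior_normP; exists (rho - `|z - x|); first by rewrite subr_gt0.
  move=> y' hy'; apply: hrho.
  have -> : y' - x = (y' - z) + (z - x) by rewrite addrA subrK.
  by apply: le_lt_trans (ler_normD _ _) _; rewrite -ltrBrDr.
have c1 : (0 < count (pred1 e) (digits m k k))%N by rewrite -has_count has_pred1.
rewrite {2}/vol mu0 //= pmulr_rle0 ?ltr0n // => v0.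
by rewrite mu_volE //; congr (_%:E); apply/eqP; rewrite eq_le v0 vol_ge0.
Qed.

(** If the tiles had no interior, then, as boundedly many tiles of the subdivision of level [m] meet a
    given unit cell, each cell would contain a subcell of fixed size missed by all of them. So the
    inflated tile would fill at most the fraction [theta < 1] of the cells it meets, contrary to
    [tile_cells], by which the total volume of these cells is close to that of the inflated tile. *)
Lemma interior_of_vol_gt0 j0 : 0 < vol (T j0) -> exists j, interior (T j) !=set0.
Proof.
move=> vj0; have v0 := vol_tiles_gt0 vj0.
apply: contrapT => nI.
have nT i x : ~ interior (T i) x by move=> hx; apply: nI; exists i, x.
have [r0 r00 hr0] := tiles_bounded.
have [M hM] := packing_bound v0 (r0 + 1).
have half0 : 0 < 2^-1 :> R by [].
have [eps eps0 heps] := finitely_many_porous hTc nT (n * M) half0.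
have [N Neps] : exists N, N.+1%:R^-1 < eps.
  by exists (Num.truncn eps^-1); rewrite invf_plt ?posrE ?ltr0n // truncnS_gt.
have qd0 : 0 < N.+1%:R ^+ d :> R by rewrite exprn_gt0 // ltr0n.
pose theta : R := 1 - (N.+1%:R ^+ d)^-1.
have th0 : 0 <= theta by rewrite subr_ge0 invf_le1 // exprn_ege1 // ler1n.
have th1 : theta < 1 by rewrite gtrDl oppr_lt0 invr_gt0.
(* This [delta] satisfies [vol (T j0) < delta] and [theta * delta < vol (T j0)]. *)
pose delta := vol (T j0) * (2 / (1 + theta)).
have hdelta : (mu (T j0) < delta%:E)%E.
  by rewrite (mu_volE (@tile_bounded j0)) lte_fin ltr_pMr // ltr_pdivlMr; lra.
have [m /(_ m (leqnn _))[K [c0 [Z [hZ cZ]]]]] := tile_cells hdelta.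
have /choice[g hg] (f : {ffun 'I_d -> 'I_K}) : exists g : {ffun 'I_d -> 'I_N.+1},
    forall x, T j0 x -> ~ subcell c0 f g (A ^+ m *m x).
  pose c := cell_corner c0 f + const_mx 2^-1.
  pose s := [seq (i, e) | i <- enum 'I_n,
     e <- [seq e <- digits m i j0 | `|e - cell_corner c0 f| <= r0 + 1]].
  have ss : (size s <= n * M)%N.
    rewrite size_allpairs_dep sumnE big_map big_enum /=.
    apply: leq_trans (_ : \sum_(i < n) M <= _)%N; last by rewrite sum_nat_const card_ord.
    by apply: leq_sum => i _; rewrite size_filter.
  have [q hq] := heps s ss c.
  have [|hq1 _] := hq q; first by rewrite subrr normr0.
  have [g hg] : exists g : {ffun 'I_d -> 'I_N.+1}, subcell c0 f g q.
    apply: subcell_cover => i; have := le_lt_trans (norm_coord (q - c) i) hq1.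
    by rewrite !mxE ltr_norml => /andP[? ?]; apply/andP; split; lra.
  exists g => x Tx hx.
  have [|h1 h2] := hq (A ^+ m *m x); first exact: le_lt_trans (subcell_dist hx hg) _.
  have [i [e eD Ti]] := tile_subdivision m Tx.
  apply: (h2 (i, e)) => //.
  apply: allpairs_f_dep; rewrite ?mem_enum // mem_filter eD andbT.
  have -> : e - cell_corner c0 f = - (A ^+ m *m x - e) + ((A ^+ m *m x - c) + const_mx 2^-1).
    by rewrite /c opprB opprD !addrA subrK addrNK.
  apply: le_trans (ler_normD _ _) _; rewrite normrN; apply: lerD; first exact: hr0 Ti.
  apply: le_trans (ler_normD _ _) _.
  have : `|const_mx 2^-1 : V| <= 2^-1 by apply: norm_le => // k; rewrite mxE ger0_norm.
  lra.
have : lam ^+ m * vol (T j0) <= #|Z|%:R * theta.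
  rewrite -lee_fin -(vol_image m (@tile_bounded j0)) -mu_volE; last first.
    exact/norm_bounded_image/tile_bounded.
  apply: (mu_le_missing_subcells hd (o := c0) (g := g)) => [_ [x Tx <-]|f _ [x Tx <-]].
    exact: hZ.
  exact: hg.
apply/negP; rewrite -ltNge; apply: le_lt_trans (ler_wpM2r th0 cZ) _.
rewrite -mulrA ltr_pM2l ?exprn_gt0 ?lam_gt0 // -mulrA -[ltRHS]mulr1 ltr_pM2l ?v0 //.
by rewrite mulrAC ltr_pdivrMr; lra.
Qed.

End Tiles.

(** * The equivalences *)

Section DigitMultisets.
Variables (R : realType) (d n : nat) (A : 'M[R]_d).
Local Notation V := 'cV[R]_d.
Variable D : 'I_n -> 'I_n -> {fset V}.

Lemma ordinary_digit_mset m i j : ordinary (digit_mset A D m i j) <-> uniq (digits A D m i j).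
Proof. by rewrite ordinaryP (perm_uniq (perm_digits A D m i j)). Qed.

Lemma count_ball_digit_mset m i j c r :
  count_ball (digit_mset A D m i j) c r = count (fun x => enorm (x - c) <= r) (digits A D m i j).
Proof. by rewrite count_ballE; exact: (seq.permP (perm_digits A D m i j)). Qed.

Lemma mem_digit_mset m i j x : (x \in digit_mset A D m i j) = (x \in digits A D m i j).
Proof. by rewrite -(perm_mem (perm_digits A D m i j)). Qed.

(** The unit ball is covered by finitely many balls of diameter less than [eps], and each of these
    contains at most one point of [s]. *)
Lemma separated_ball_bound (hd : (1 <= d)%N) (eps : R) : 0 < eps ->
  exists M, forall s : seq V, uniq s ->
  (forall x y, x \in s -> y \in s -> x != y -> eps <= enorm (x - y)) ->
  forall c, (count (fun x : V => (enorm (x - c) <= 1)%R) s <= M)%N.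
Proof.
move=> eps0; have d0 : 0 < d%:R :> R by rewrite ltr0n.
have e30 : 0 < eps / (3 * d%:R) by rewrite divr_gt0 // mulr_gt0.
have [C hC] := @cover_by_balls R d 1 _ ltr01 e30.
exists (size C * 1)%N => s su sep c.
apply: (count_le_cover_bound (C := C) (Q := fun c1 x => (`|x - c - c1| <= eps / (3 * d%:R))%R)).
  move=> x xc; apply: hC; exact: le_trans (norm_le_enorm _) xc.
move=> c1; rewrite -size_filter.
set t := (X in size X); have tu : uniq t by rewrite filter_uniq.
have ht x : x \in t -> x \in s /\ `|x - c - c1| <= eps / (3 * d%:R).
  by rewrite mem_filter => /andP[].
case: t tu ht => [//|x [//|y t]] /= /andP[xt _] ht.
have [xs hx] := ht x (mem_head _ _).
have [ys hy] : y \in s /\ `|y - c - c1| <= eps / (3 * d%:R) by apply: ht; rewrite !inE eqxx orbT.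
(* Two points in one small ball are at Euclidean distance at most [2 / 3 * eps]. *)
have xy : x != y by apply: contraNneq xt => ->; rewrite mem_head.
have := le_trans (sep x y xs ys xy) (enorm_le_norm _).
have -> : x - y = (x - c - c1) - (y - c - c1) by rewrite !opprB addrA subrK addrA subrK.
have h : `|(x - c - c1) - (y - c - c1)| <= eps / (3 * d%:R) * 2.
  by apply: le_trans (ler_normB _ _) _; lra.
move=> /le_trans/(_ (ler_wpM2l (ltW d0) h)).
have -> : d%:R * (eps / (3 * d%:R) * 2) = eps * (2 / 3).
  by rewrite invfM; field; rewrite gt_eqF.
by move=> h2; exfalso; lra.
Qed.

End DigitMultisets.

Theorem theorem5p5 (R : realType) (d n : nat) (hd : (1 <= d)%N) (hn : (1 <= n)%N)
  (A : 'M[R]_d) (hA : expanding A)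
  (D : 'I_n -> 'I_n -> {fset 'cV[R]_d})
  (T : 'I_n -> set 'cV[R]_d)
  (hT0 : forall i, T i !=set0) (hTc : forall i, compact (T i))
  (hT : multi_tile_equation A D T)
  (hprim : primitive_mx (subdivision_mx D))
  (hperron : is_perron_eigenvalue (subdivision_mx D) `|\det A|) :
  [<->
    (* i *)
    (forall m, (1 <= m)%N -> forall i j, ordinary (digit_mset A D m i j)) /\
    equi_uniformly_discrete
      [set E | exists i j m, (1 <= m)%N /\ E = digit_mset A D m i j];
    (* ii *)
    exists k l,
      (forall m, (1 <= m)%N -> ordinary (digit_mset A D m k l)) /\
      equi_uniformly_discrete
        [set E | exists m, (1 <= m)%N /\ E = digit_mset A D m k l];
    (* iii *)
    weakly_equi_uniformly_discrete
      [set E | exists i j m, (1 <= m)%N /\ E = digit_mset A D m i j];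
    (* iv *)
    exists k l, weakly_equi_uniformly_discrete
      [set E | exists m, (1 <= m)%N /\ E = digit_mset A D m k l];
    (* v *)
    exists j, (0 < lebesgue_mu (T j))%E;
    (* vi *)
    forall j, T j = closure (interior (T j));
    (* vii *)
    forall j, T j = closure (interior (T j)) /\
      lebesgue_mu (boundary (T j)) = 0%E
  ] /\
  ((forall j, T j = closure (interior (T j))) ->
   forall j, (0 < lebesgue_mu (T j))%E).
Proof.
have [u u0 Su] := perron_positive_eigenvector hprim hperron.
have [_ [p p0 Sp]] := hprim.
pose k0 : 'I_n := Ordinal hn.
have muT j : lebesgue_mu (T j) = (vol (T j))%:E by apply: mu_volE (tile_bounded hTc _).
have int_ne : (forall j, T j = closure (interior (T j))) -> forall j, interior (T j) !=set0.
  move=> h j; apply/set0P/negP => /eqP e; have [t] := hT0 j.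
  by rewrite h e closure0.
have pos : (forall j, T j = closure (interior (T j))) -> forall j, 0 < vol (T j).
  move=> h j; exact (vol_gt0_of_interior hd hA hTc (int_ne h j)).
have transfer k l M : (forall m, (1 <= m)%N -> ball_bound A D m k l M) ->
    exists M', forall m, (1 <= m)%N -> forall i j c,
      (count (fun e : 'cV[R]_d => (`|e - c| <= 1)%R) (digits A D m i j) <= M')%N.
  by move=> hM; exact: (weak_bound_transfer hd Sp hM ltr01).
split; last by move=> /pos h j; rewrite muT lte_fin.
tfae.
- move=> [h1 [eps eps0 h2]]; exists k0, k0; split; first by move=> m /h1.
  by exists eps => // E [m [m1 ->]]; apply: h2; exists k0, k0, m.
- move=> [k [l [h1 [eps eps0 h2]]]].
  have [M hM] := @separated_ball_bound R d hd eps eps0.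
  have [|M' hM'] := transfer k l M.
    move=> m m1 c; have [h3 h4] : uniformly_discrete eps (digit_mset A D m k l).
      by apply: h2; exists m.
    apply: hM; first exact/ordinary_digit_mset.
    by move=> x y; rewrite -!mem_digit_mset; exact: h4.
  exists M'.+1 => // _ [i [j [m [m1 ->]]]] c; rewrite count_ball_digit_mset.
  apply: leqW; apply: leq_trans (hM' m m1 i j c); apply: sub_count => x.
  exact: le_trans (norm_le_enorm _).
- move=> [M M0 hM]; exists k0, k0, M => // E [m [m1 ->]]; apply: hM.
  by exists k0, k0, m.
- move=> [k [l [M M0 hM]]].
  have [|M' hM'] := transfer k l M.
    by move=> m m1 c; rewrite -count_ball_digit_mset; apply: hM; exists m.
  have [j hj] := vol_gt0_of_weak_bound hd hA hT0 hTc hT u0 Su hn hM'.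
  by exists j; rewrite muT.
- move=> [j]; rewrite muT lte_fin => hj.
  have [j0 hj0] := interior_of_vol_gt0 hd hA hTc hT u0 Su Sp hj.
  exact (tile_closure_interior hA hTc hT Sp hj0).
- move=> h j; split; first exact: h.
  exact: (vol_boundary_eq0 hd hA hT0 hTc hT u0 Su Sp h).
- move=> h; have v0 := pos (fun j => (h j).1).
  split.
    by move=> m _ i j; apply/ordinary_digit_mset; exact: (uniq_digits hd hA hTc hT u0 Su v0).
  have [eps eps0 sep] := digits_separated hd hA hTc hT u0 Su v0.
  exists eps => // E [i [j [m [m1 ->]]]]; split.
    by apply/ordinary_digit_mset; exact: (uniq_digits hd hA hTc hT u0 Su v0).
  move=> x y; rewrite !mem_digit_mset => xD yD xy.
  exact: le_trans (sep _ _ _ _ _ xD yD xy) (norm_le_enorm _).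
Qed.
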